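(* Let $\mathcal{H},\mathcal{K}$ be Hilbert spaces. Let $\mathfrak{M}$ be an $n$-variable operator mean (on $\mathbb{P}(\mathcal{H})$ and on $\mathbb{P}(\mathcal{K})$) satisfying $\mathcal{H}_\omega\le\mathfrak{M}\le\mathcal{A}_\omega$ for some probability vector $\omega=(\omega_1,\ldots,\omega_n)$, and let $\sigma$ be a ($2$-variable) operator mean with $\sigma\ne\ell$. Let $A_1,\ldots,A_n\in\mathbb{P}(\mathcal{H})$ be such that $mI\le A_j\le MI$ $(j=1,\ldots,n)$ for some scalars $0<m<M$. Then for each $\alpha>0$ $$\mathfrak{M}_\sigma(\Phi(A_1^r),\ldots,\Phi(A_n^r))\le\alpha\,\Phi(\mathfrak{M}_\sigma(A_1,\ldots,A_n)^r)+\gamma(1/M,1/m,-r,\alpha)I$$ for all $r\in(0,1]$ and all unital positive linear maps $\Phi:\mathbb{B}(\mathcal{H})\to\mathbb{B}(\mathcal{K})$.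
   Context: $\mathbb{B}(\mathcal{H})$ is the algebra of bounded linear operators on a Hilbert space $\mathcal{H}$, $\mathbb{B}(\mathcal{H})^+$ its cone of positive operators, $\mathbb{P}(\mathcal{H})$ the set of positive invertible operators; $\le$ is the operator (Loewner) order, $I$ the identity, SOT the strong operator topology. A ($2$-variable, Kubo--Ando) operator mean is a map $\sigma:\mathbb{B}(\mathcal{H})^+\times\mathbb{B}(\mathcal{H})^+\to\mathbb{B}(\mathcal{H})^+$ with: (i) $A\le C,\ B\le D\Rightarrow A\sigma B\le C\sigma D$; (ii) $C(A\sigma B)C\le (CAC)\sigma(CBC)$ for $C\in\mathbb{B}(\mathcal{H})^+$; (iii) $A_k\searrow A,\ B_k\searrow B\Rightarrow A_k\sigma B_k\searrow A\sigma B$ (decreasing sequences converging in SOT); (iv) $I\sigma I=I$. Operator means correspond one-to-one to nonnegative operator monotone functions $f_\sigma$ on $(0,\infty)$ with $f_\sigma(1)=1$ via $A\sigma B=A^{1/2}f_\sigma(A^{-1/2}BA^{-1/2})A^{1/2}$ for positive invertible $A,B$ (so $\sigma$ makes sense on every Hilbert space). The left trivial mean is $A\ell B=A$. An $n$-variable operator mean is a map $\mathfrak{M}:\mathbb{P}(\mathcal{H})^n\to\mathbb{P}(\mathcal{H})$ with: (I) $A_j\le B_j$ for all $j$ implies $\mathfrak{M}(A_1,\ldots,A_n)\le\mathfrak{M}(B_1,\ldots,B_n)$; (II) $S^*\mathfrak{M}(A_1,\ldots,A_n)S=\mathfrak{M}(S^*A_1S,\ldots,S^*A_nS)$ for every invertible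 $S\in\mathbb{B}(\mathcal{H})$; (III) if either $A_{jk}\nearrow A_j$ or $A_{jk}\searrow A_j$ as $k\to\infty$ for each $j$ (all in $\mathbb{P}(\mathcal{H})$), then $\mathfrak{M}(A_{1k},\ldots,A_{nk})\to\mathfrak{M}(A_1,\ldots,A_n)$ in SOT; (IV) $\mathfrak{M}(I,\ldots,I)=I$. The same symbol $\mathfrak{M}$ denotes a mean with these properties on $\mathbb{P}(\mathcal{K})$ when it is applied to operators on $\mathcal{K}$, and all stated hypotheses on $\mathfrak{M}$ are meant on both spaces. For an $n$-variable operator mean $\mathfrak{M}$ and an operator mean $\sigma\ne\ell$, the deformed mean $\mathfrak{M}_\sigma(A_1,\ldots,A_n)$ is the unique solution $X\in\mathbb{P}$ of $X=\mathfrak{M}(X\sigma A_1,\ldots,X\sigma A_n)$ (existence and uniqueness are known, and $\mathfrak{M}_\sigma$ is again an $n$-variable operator mean). A probability vector has $\omega_j\ge0$, $\sum_j\omega_j=1$. $\mathcal{A}_\omega(A_1,\ldots,A_n)=\sum_j\omega_jA_j$ and $\mathcal{H}_\omega(A_1,\ldots,A_n)=(\sum_j\omega_jA_j^{-1})^{-1}$; $\mathcal{H}_\omega\le\mathfrak{M}\le\mathcal{A}_\omega$ means the inequality holds at every $n$-tuple of positive invertible operators. For $0<m<M$, $r\in\mathbb{R}\setminus\{0,1\}$, $\alpha>0$, put $t_0=\left(\frac{M^r-m^r}{\alpha r(M-m)}\right)^{1/(r-1)}$ and $$\gamma(m,M,r,\alpha)=\begin{cases}\alpha(r-1)\left(\frac{M^r-m^r}{\alpha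 r(M-m)}\right)^{r/(r-1)}+\frac{Mm^r-mM^r}{M-m}&\text{if } m\le t_0\le M,\\ (1-\alpha)M^r&\text{if } M\le t_0,\\ (1-\alpha)m^r&\text{if } t_0\le m.\end{cases}$$ In the claim this is evaluated with $(m,M,r)$ replaced by $(1/M,1/m,-r)$. *)

(* Defs.v *)
From HB Require Import structures.
From mathcomp Require Import all_boot all_order all_algebra.
From mathcomp Require Import complex.
From mathcomp Require Import all_classical all_reals all_analysis.

Set Implicit Arguments.
Unset Strict Implicit.
Unset Printing Implicit Defensive.

Import Order.TTheory GRing.Theory Num.Theory.
Import numFieldNormedType.Exports.

Local Open Scope classical_set_scope.
Local Open Scope ring_scope.
Local Open Scope complex_scope.

(* Complex Hilbert spaces, separable or not, of any dimension; the inner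
   product is linear in its first argument. *)
HB.mixin Record CompleteNormedModule_isHilbert (R : realType) H
    of CompleteNormedModule R[i] H := {
  hdot : H -> H -> R[i];
  hdot_linearl : forall (a : R[i]) (x y z : H),
    hdot (a *: x + y) z = a * hdot x z + hdot y z;
  hdotC : forall x y : H, hdot x y = Num.conj (hdot y x);
  hdot_norm : forall x : H, `|x| ^+ 2 = hdot x x
}.

#[short(type="hilbertType")]
HB.structure Definition Hilbert (R : realType) :=
  { H of CompleteNormedModule_isHilbert R H & CompleteNormedModule R[i] H }.

Definition bounded_op_pred (R : realType) (H : hilbertType R) : {pred H -> H} :=
  [pred T : H -> H | `[< linear T /\ continuous T >]].
Arguments bounded_op_pred {R} H.

Record bounded_op (R : realType) (H : hilbertType R) := BoundedOp {
  bop_fun :> H -> H ;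
  bop_funP : bop_fun \in bounded_op_pred H
}.

Notation "''B' ( H )" := (bounded_op H)
  (at level 0, H at level 99, format "''B' ( H )") : type_scope.

HB.instance Definition _ (R : realType) (H : hilbertType R) :=
  [isSub for @bop_fun R H].
HB.instance Definition _ (R : realType) (H : hilbertType R) :=
  [Choice of 'B(H) by <:].

Lemma bounded_op_submod (R : realType) (H : hilbertType R) :
  submod_closed (bounded_op_pred H : {pred (H -> H : lmodType R[i])}).
Proof.
split=> [|a S T /asboolP[Sl Sc] /asboolP[Tl Tc]]; apply/asboolP; split.
- by move=> b x y; rewrite /= scaler0 addr0.
- exact: cst_continuous.
- move=> b x y; rewrite /= -![(_ + _) (_ : H)]/(_ + _) -![(a *: S) _]/(a *: S _).
  rewrite Sl Tl !scalerDr !scalerA mulrC -!addrA; congr (_ + _).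
  by rewrite addrCA.
- move=> x; apply: cvgD; last exact: Tc.
  by apply: cvgZr; exact: Sc.
Qed.

HB.instance Definition _ (R : realType) (H : hilbertType R) :=
  GRing.isSubmodClosed.Build _ _ _ (@bounded_op_submod R H).

HB.instance Definition _ (R : realType) (H : hilbertType R) :=
  [SubChoice_isSubLmodule of 'B(H) by <:].

Lemma bop_one_subproof (R : realType) (H : hilbertType R) :
  idfun \in bounded_op_pred H.
Proof. by apply/asboolP; split => // x; exact: cvg_id. Qed.

Lemma bop_mul_subproof (R : realType) (H : hilbertType R) (S T : 'B(H)) :
  S \o T \in bounded_op_pred H.
Proof.
have /asboolP[Sl Sc] := bop_funP S; have /asboolP[Tl Tc] := bop_funP T.
apply/asboolP; split=> [a x y|x]; first by rewrite /= Tl Sl.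
by apply: continuous_comp; [exact: Tc | exact: Sc].
Qed.

Definition bop_one (R : realType) (H : hilbertType R) : 'B(H) :=
  BoundedOp (bop_one_subproof H).

Definition bop_mul (R : realType) (H : hilbertType R) (S T : 'B(H)) : 'B(H) :=
  BoundedOp (bop_mul_subproof S T).

Lemma bop_mulA (R : realType) (H : hilbertType R) : associative (@bop_mul R H).
Proof. by move=> S T U; apply: val_inj. Qed.

Lemma bop_1mul (R : realType) (H : hilbertType R) :
  left_id (bop_one H) (@bop_mul R H).
Proof. by move=> S; apply: val_inj. Qed.

Lemma bop_mul1 (R : realType) (H : hilbertType R) :
  right_id (bop_one H) (@bop_mul R H).
Proof. by move=> S; apply: val_inj. Qed.

Lemma bop_mulDl (R : realType) (H : hilbertType R) :
  left_distributive (@bop_mul R H) +%R.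
Proof. by move=> S T U; apply: val_inj. Qed.

Lemma bop_mulDr (R : realType) (H : hilbertType R) :
  right_distributive (@bop_mul R H) +%R.
Proof.
move=> S T U; apply: val_inj; apply/funext => x.
have /asboolP[Sl _] := bop_funP S.
by have := Sl 1 (T x) (U x); rewrite !scale1r.
Qed.

(* The product of 'B(H) is composition. *)
HB.instance Definition _ (R : realType) (H : hilbertType R) :=
  GRing.Zmodule_isPzRing.Build 'B(H) (@bop_mulA R H) (@bop_1mul R H)
    (@bop_mul1 R H) (@bop_mulDl R H) (@bop_mulDr R H).

(* [0 <= z] in [R[i]] means that z is real and nonnegative. *)
Definition positive_op (R : realType) (H : hilbertType R) (A : 'B(H)) : Prop :=
  forall x : H, 0 <= hdot (A x) x.

Definition loewner_le (R : realType) (H : hilbertType R) (A B : 'B(H)) : Prop :=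
  positive_op (B - A).

Notation "A '<=op' B" := (loewner_le A B) (at level 70, no associativity).

Definition is_inverse (R : realType) (H : hilbertType R) (A B : 'B(H)) : Prop :=
  A * B = 1 /\ B * A = 1.

Definition invertible_op (R : realType) (H : hilbertType R) (A : 'B(H)) : Prop :=
  exists B : 'B(H), is_inverse A B.

(* Junk value 0 when A is not invertible. *)
Definition inv_op (R : realType) (H : hilbertType R) (A : 'B(H)) : 'B(H) :=
  xget 0 [set B | is_inverse A B].

Definition pos_inv (R : realType) (H : hilbertType R) (A : 'B(H)) : Prop :=
  positive_op A /\ invertible_op A.

Definition is_adjoint (R : realType) (H : hilbertType R) (S T : 'B(H)) : Prop :=
  forall x y : H, hdot (S x) y = hdot x (T y).

Definition spectrum (R : realType) (H : hilbertType R) (A : 'B(H)) : set R[i] :=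
  [set z | ~ invertible_op (A - z *: (1 : 'B(H)))].

Definition poly_op (R : realType) (H : hilbertType R) (p : {poly R}) (A : 'B(H))
    : 'B(H) :=
  \sum_(i < size p) (p`_i)%:C *: A ^+ i.

Definition opnorm_le (R : realType) (H : hilbertType R) (A : 'B(H)) (c : R)
    : Prop :=
  forall x : H, `|A x| <= c%:C * `|x|.

(* Continuous functional calculus of a self-adjoint operator A: B = f(A) is the
   norm limit of p(A) as the real polynomials p converge to f uniformly on the
   (real) spectrum of A. *)
Definition is_cfc (R : realType) (H : hilbertType R) (f : R -> R) (A B : 'B(H))
    : Prop :=
  forall e : R, 0 < e -> exists p : {poly R},
    (forall t : R, spectrum A t%:C -> `|p.[t] - f t| <= e) /\
    opnorm_le (poly_op p A - B) e.

Definition cfc (R : realType) (H : hilbertType R) (f : R -> R) (A : 'B(H))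
    : 'B(H) :=
  xget 0 [set B | is_cfc f A B].

Definition pow_op (R : realType) (H : hilbertType R) (A : 'B(H)) (r : R)
    : 'B(H) :=
  cfc (fun t => t `^ r) A.

Definition sot_cvg (R : realType) (H : hilbertType R) (A_ : nat -> 'B(H))
    (A : 'B(H)) : Prop :=
  forall x : H, A_ k x @[k --> \oo] --> A x.

Definition sot_decr (R : realType) (H : hilbertType R) (A_ : nat -> 'B(H))
    (A : 'B(H)) : Prop :=
  (forall k, A_ k.+1 <=op A_ k) /\ sot_cvg A_ A.

Definition sot_incr (R : realType) (H : hilbertType R) (A_ : nat -> 'B(H))
    (A : 'B(H)) : Prop :=
  (forall k, A_ k <=op A_ k.+1) /\ sot_cvg A_ A.

(* Maps on positive (invertible) operators are total functions on 'B(H) whose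
   values outside the intended domain are irrelevant: every axiom below is
   relativized to it. *)

Record kubo_ando_axioms (R : realType) (H : hilbertType R)
    (s : 'B(H) -> 'B(H) -> 'B(H)) : Prop := {
  mean_positive : forall A B,
    positive_op A -> positive_op B -> positive_op (s A B) ;
  mean_monotone : forall A B C D,
    positive_op A -> positive_op B -> positive_op C -> positive_op D ->
    A <=op C -> B <=op D -> s A B <=op s C D ;
  mean_transformer : forall A B C,
    positive_op A -> positive_op B -> positive_op C ->
    C * s A B * C <=op s (C * A * C) (C * B * C) ;
  mean_continuous : forall (A_ B_ : nat -> 'B(H)) A B,
    (forall k, positive_op (A_ k)) -> (forall k, positive_op (B_ k)) ->
    positive_op A -> positive_op B ->
    sot_decr A_ A -> sot_decr B_ B ->
    sot_decr (fun k => s (A_ k) (B_ k)) (s A B) ;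
  mean_normalized : s 1 1 = 1
}.

Definition operator_monotone (R : realType) (f : R -> R) : Prop :=
  {in `]0, +oo[, continuous f} /\
  forall (H : hilbertType R) (A B : 'B(H)),
    pos_inv A -> pos_inv B -> A <=op B -> cfc f A <=op cfc f B.

Definition represents (R : realType) (f : R -> R) (H : hilbertType R)
    (s : 'B(H) -> 'B(H) -> 'B(H)) : Prop :=
  forall A B, pos_inv A -> pos_inv B ->
    s A B = pow_op A 2^-1
            * cfc f (pow_op A (- 2^-1) * B * pow_op A (- 2^-1))
            * pow_op A 2^-1.

(* An operator mean acts on every Hilbert space; its actions are tied together
   by a common representing function.  On a fixed space of small dimension the
   Kubo-Ando axioms alone would not determine such a function. *)
Definition operator_mean (R : realType)
    (sigma : forall H : hilbertType R, 'B(H) -> 'B(H) -> 'B(H)) : Prop :=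
  (forall H, kubo_ando_axioms (sigma H)) /\
  exists f : R -> R,
    [/\ operator_monotone f, forall t, 0 < t -> 0 <= f t, f 1 = 1
       & forall H, represents f (sigma H)].

Definition left_trivial_mean (R : realType)
    (sigma : forall H : hilbertType R, 'B(H) -> 'B(H) -> 'B(H)) : Prop :=
  forall (H : hilbertType R) (A B : 'B(H)),
    positive_op A -> positive_op B -> sigma H A B = A.

Record n_operator_mean (R : realType) (H : hilbertType R) (n : nat)
    (M : ('I_n -> 'B(H)) -> 'B(H)) : Prop := {
  nmean_pos_inv : forall A,
    (forall j, pos_inv (A j)) -> pos_inv (M A) ;
  nmean_monotone : forall A B,
    (forall j, pos_inv (A j)) -> (forall j, pos_inv (B j)) ->
    (forall j, A j <=op B j) -> M A <=op M B ;
  nmean_congruence : forall A S T,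
    (forall j, pos_inv (A j)) -> invertible_op S -> is_adjoint S T ->
    T * M A * S = M (fun j => T * A j * S) ;
  nmean_continuous : forall (A_ : nat -> 'I_n -> 'B(H)) A,
    (forall k j, pos_inv (A_ k j)) -> (forall j, pos_inv (A j)) ->
    (forall j, sot_incr (A_ ^~ j) (A j)) \/
    (forall j, sot_decr (A_ ^~ j) (A j)) ->
    sot_cvg (fun k => M (A_ k)) (M A) ;
  nmean_normalized : M (fun=> 1) = 1
}.

Definition is_deformed_mean (R : realType) (H : hilbertType R) (n : nat)
    (M : ('I_n -> 'B(H)) -> 'B(H)) (s : 'B(H) -> 'B(H) -> 'B(H))
    (Ms : ('I_n -> 'B(H)) -> 'B(H)) : Prop :=
  forall A, (forall j, pos_inv (A j)) ->
    unique (fun X => pos_inv X /\ X = M (fun j => s X (A j))) (Ms A).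

Definition arith_mean (R : realType) (H : hilbertType R) (n : nat)
    (w : 'I_n -> R) (A : 'I_n -> 'B(H)) : 'B(H) :=
  \sum_(j < n) (w j)%:C *: A j.

Definition harm_mean (R : realType) (H : hilbertType R) (n : nat)
    (w : 'I_n -> R) (A : 'I_n -> 'B(H)) : 'B(H) :=
  inv_op (\sum_(j < n) (w j)%:C *: inv_op (A j)).

Definition between_harm_arith (R : realType) (H : hilbertType R) (n : nat)
    (w : 'I_n -> R) (M : ('I_n -> 'B(H)) -> 'B(H)) : Prop :=
  forall A, (forall j, pos_inv (A j)) ->
    harm_mean w A <=op M A /\ M A <=op arith_mean w A.

Definition probability_vector (R : realType) (n : nat) (w : 'I_n -> R) : Prop :=
  (forall j, 0 <= w j) /\ \sum_(j < n) w j = 1.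

Definition unital_positive (R : realType) (H K : hilbertType R)
    (Phi : 'B(H) -> 'B(K)) : Prop :=
  Phi 1 = 1 /\ forall A, positive_op A -> positive_op (Phi A).

Definition gamma_base (R : realType) (m M r alpha : R) : R :=
  (M `^ r - m `^ r) / (alpha * r * (M - m)).

Definition gamma_t0 (R : realType) (m M r alpha : R) : R :=
  gamma_base m M r alpha `^ (r - 1)^-1.

Definition gamma_const (R : realType) (m M r alpha : R) : R :=
  let t0 := gamma_t0 m M r alpha in
  if m <= t0 <= M then
    alpha * (r - 1) * gamma_base m M r alpha `^ (r / (r - 1))
    + (M * m `^ r - m * M `^ r) / (M - m)
  else if M <= t0 then (1 - alpha) * M `^ r
  else (1 - alpha) * m `^ r.

(* Main.v *)
(** Write [X] for the deformed mean of the [A j].  The function [f] representing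
    [sigma] is monotone on 2x2 matrices; this already makes it concave, and
    since [f] is not constant it lies below a line through [(1, 1)] of positive
    slope.  The same applies to [t |-> 1 / f (1 / t)].  Inserting these tangents
    into the fixed point equation [X = M (X sigma A j)] transports the bounds
    [H_w <= M <= A_w] to the deformed mean.  Hence the left-hand side is at most
    [Phi (\sum_j w j * A j ^ r)], while [X ^ r >= H_w (A) ^ r] by the
    Loewner-Heinz inequality, and the two are compared by the Mond-Pecaric
    method: the convex function [u ^ (- r)] of [u = 1 / t] is below its chord on
    [[1 / M, 1 / m]], which depends linearly on the [inv_op (A j)]. *)

(* The tangent [f t <= 1 + s * (t - 1)] bounds each [X sigma A j] by [(1 - s) X + s A j]. With
   [M <= A_w] the fixed point equation then gives [X <= (1 - s) X + s A_w (A)]: the unknown cancels,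
   and dividing by [s] is where a positive slope is indispensable. In this way only scalar
   inequalities are pushed through the functional calculus, and no operator Jensen inequality for
   [f] has to be proved. Concavity of [f] comes from compression. A corner of a symmetric 2x2 matrix
   is a convex combination of its eigenvalues, and [diag (p, l)] with [l] large dominates the matrix
   as soon as [p] exceeds that corner. The map [Phi] is handled by linearity and positivity alone:
   the comparison of [\sum_j w j * A j ^ r] with a power of the harmonic mean is finished on [H]
   before [Phi] is applied. The constant [gamma] is the maximum over [[1 / M, 1 / m]] of the chord
   minus [alpha * u ^ (- r)]. *)
From HB Require Import structures.
Require Import Defs.
From mathcomp Require Import all_boot all_order all_algebra.
From mathcomp Require Import complex ring lra.
From mathcomp Require Import all_classical all_reals all_analysis.
Import Order.TTheory GRing.Theory Num.Theory.
Import numFieldNormedType.Exports.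
Local Open Scope ring_scope.
Local Open Scope complex_scope.

Set Implicit Arguments.
Unset Strict Implicit.
Unset Printing Implicit Defensive.

(** * The real inner product [Re <x, y>] and bounded operators *)

Section RealInnerProduct.
Context {R : realType} {H : hilbertType R}.
Implicit Types (x y z : H) (a : R).

(** Order and self-adjointness can be tested on real parts, which turns estimates into real
    arithmetic; imaginary parts are recovered by multiplying a vector by ['i]. *)
Definition rdot x y : R := complex.Re (hdot x y).

Definition nrm x : R := complex.Re `|x|.

Lemma ReD (u v : R[i]) : complex.Re (u + v) = complex.Re u + complex.Re v.
Proof. by case: u v => ? ? [? ?]. Qed.

Lemma ReZ a (u : R[i]) : complex.Re (a%:C * u) = a * complex.Re u.
Proof. by case: u => ? ? /=; rewrite mul0r subr0. Qed.

Lemma hdotDl x y z : hdot (x + y) z = hdot x z + hdot y z.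
Proof. by have := hdot_linearl 1 x y z; rewrite scale1r mul1r. Qed.

Lemma hdot0l z : hdot (0 : H) z = 0.
Proof.
by apply: (addrI (hdot (0 : H) z)); rewrite -hdotDl !addr0.
Qed.

Lemma hdotZl (c : R[i]) x z : hdot (c *: x) z = c * hdot x z.
Proof. by have := hdot_linearl c x 0 z; rewrite hdot0l !addr0. Qed.

Lemma rdotC x y : rdot x y = rdot y x.
Proof. by rewrite /rdot hdotC; case: (hdot y x). Qed.

Lemma rdotDl x y z : rdot (x + y) z = rdot x z + rdot y z.
Proof. by rewrite /rdot hdotDl ReD. Qed.

Lemma rdotZl a x y : rdot (a%:C *: x) y = a * rdot x y.
Proof. by rewrite /rdot hdotZl ReZ. Qed.

Lemma rdotDr x y z : rdot x (y + z) = rdot x y + rdot x z.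
Proof. by rewrite rdotC rdotDl !(rdotC x). Qed.

Lemma rdotZr a x y : rdot x (a%:C *: y) = a * rdot x y.
Proof. by rewrite rdotC rdotZl (rdotC x). Qed.

Lemma scaleN1c x : - x = (- 1)%:C *: x.
Proof. by rewrite rmorphN1 scaleN1r. Qed.

Lemma rdotNl x y : rdot (- x) y = - rdot x y.
Proof. by rewrite scaleN1c rdotZl mulN1r. Qed.

Lemma rdotNr x y : rdot x (- y) = - rdot x y.
Proof. by rewrite scaleN1c rdotZr mulN1r. Qed.

Lemma rdotBl x y z : rdot (x - y) z = rdot x z - rdot y z.
Proof. by rewrite rdotDl rdotNl. Qed.

Lemma rdotBr x y z : rdot x (y - z) = rdot x y - rdot x z.
Proof. by rewrite rdotDr rdotNr. Qed.

Lemma rdot0l y : rdot 0 y = 0.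
Proof. by rewrite /rdot hdot0l. Qed.

Lemma rdot0r y : rdot y 0 = 0.
Proof. by rewrite rdotC rdot0l. Qed.

Definition rdotE := (rdotDl, rdotDr, rdotNl, rdotNr, rdotZl, rdotZr).

Lemma nrmE x : `|x| = (nrm x)%:C.
Proof. by rewrite RRe_real// normr_real. Qed.

Lemma nrm_ge0 x : 0 <= nrm x.
Proof. by rewrite -ler0c -nrmE. Qed.

Lemma sqr_nrm x : nrm x ^+ 2 = rdot x x.
Proof. by rewrite /rdot -hdot_norm nrmE -rmorphXn. Qed.

Lemma rdot_ge0 x : 0 <= rdot x x.
Proof. by rewrite -sqr_nrm sqr_ge0. Qed.

Lemma nrm0_eq0 x : nrm x = 0 -> x = 0.
Proof. by move=> x0; apply/normr0_eq0; rewrite nrmE x0. Qed.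

Lemma rdot_eq0 x : rdot x x = 0 -> x = 0.
Proof. by rewrite -sqr_nrm => /eqP; rewrite sqrf_eq0 => /eqP/nrm0_eq0. Qed.

Lemma nrm0 : nrm 0 = 0.
Proof. by rewrite /nrm normr0. Qed.

Lemma nrmN x : nrm (- x) = nrm x.
Proof. by rewrite /nrm normrN. Qed.

Lemma nrm_sub x y : nrm (x - y) = nrm (y - x).
Proof. by rewrite -nrmN opprB. Qed.

Lemma ler_nrmD x y : nrm (x + y) <= nrm x + nrm y.
Proof. by rewrite -lecR rmorphD /= -!nrmE; exact: ler_normD. Qed.

Lemma nrmZ a x : nrm (a%:C *: x) = `|a| * nrm x.
Proof.
by rewrite /nrm normrZ nrmE normc_def ReZ /= expr0n addr0 sqrtr_sqr.
Qed.

Lemma cauchy_schwarz x y : rdot x y ^+ 2 <= rdot x x * rdot y y.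
Proof.
have h : 0 <= rdot ((rdot y y)%:C *: x - (rdot x y)%:C *: y)
                   ((rdot y y)%:C *: x - (rdot x y)%:C *: y) by exact: rdot_ge0.
have [y0|y0] := eqVneq (rdot y y) 0.
  by rewrite (rdot_eq0 y0) !rdot0r expr0n mulr0.
have yp : 0 < rdot y y by rewrite lt_neqAle eq_sym y0 rdot_ge0.
rewrite -(ler_pM2l yp) -subr_ge0; apply: le_trans h _.
by rewrite !rdotE (rdotC y x); lra.
Qed.

Lemma rdot_le_nrm x y : `|rdot x y| <= nrm x * nrm y.
Proof.
rewrite -(ler_pXn2r (n := 2)) ?nnegrE ?mulr_ge0 ?nrm_ge0//.
by rewrite exprMn !sqr_nrm real_normK ?num_real// cauchy_schwarz.
Qed.

End RealInnerProduct.

Section Operators.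
Context {R : realType} {H : hilbertType R}.
Implicit Types (x y z : H) (a c : R) (A B T : 'B(H)).

Lemma bop_ext A B : (forall x, A x = B x) -> A = B.
Proof. by move=> AB; apply/val_inj/funext. Qed.

Lemma bop_linear A : linear A.
Proof. by have /asboolP[] := bop_funP A. Qed.

Lemma bopD A x y : A (x + y) = A x + A y.
Proof. by have := bop_linear A 1 x y; rewrite !scale1r. Qed.

Lemma bop0 A : A 0 = 0.
Proof. by apply: (addrI (A 0)); rewrite -bopD !addr0. Qed.

Lemma bopZ A (k : R[i]) x : A (k *: x) = k *: A x.
Proof. by have := bop_linear A k x 0; rewrite bop0 !addr0. Qed.

Lemma bopN A x : A (- x) = - A x.
Proof. by rewrite -scaleN1r bopZ scaleN1r. Qed.

Lemma addopE A B x : (A + B) x = A x + B x. Proof. by []. Qed.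
Lemma oppopE A x : (- A) x = - A x. Proof. by []. Qed.
Lemma scaleopE (k : R[i]) A x : (k *: A) x = k *: A x. Proof. by []. Qed.
Lemma mulopE A B x : (A * B) x = A (B x). Proof. by []. Qed.
Lemma oneopE x : (1 : 'B(H)) x = x. Proof. by []. Qed.
Lemma zeroopE x : (0 : 'B(H)) x = 0. Proof. by []. Qed.

Definition opE := (addopE, oppopE, scaleopE, mulopE, oneopE, zeroopE).

Lemma bop_bounded A : exists2 c, 0 < c & forall x, nrm (A x) <= c * nrm x.
Proof.
have /asboolP[Al Ac] := bop_funP A.
pose f : {linear H -> H} := HB.pack (bop_fun A) (GRing.isLinear.Build _ _ _ _ _ Al).
have /linear_boundedP [k [kr kf]] : bounded_near f (nbhs (0 : H)).
  by apply: continuous_linear_bounded; exact: Ac.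
have k1 : k < (complex.Re k + 1)%:C by rewrite -[k in k < _]RRe_real// ltcR; lra.
exists (`|complex.Re k| + 1) => [|x]; first by rewrite ltr_wpDl.
have := kf _ k1 x; rewrite !nrmE -rmorphM lecR => /le_trans; apply.
by rewrite ler_wpM2r ?nrm_ge0// lerD2r ler_norm.
Qed.

Lemma mk_bop (f : H -> H) c : linear f -> (forall x, nrm (f x) <= c * nrm x) ->
  exists T, forall x, T x = f x.
Proof.
move=> fl fc.
pose g : {linear H -> H} := HB.pack f (GRing.isLinear.Build _ _ _ _ _ fl).
have gc : continuous g.
  apply: bounded_linear_continuous; apply/linear_boundedP.
  exists c%:C; split; first by apply/complex_realP; exists c.
  move=> r cr x; apply: (@le_trans _ _ (c%:C * `|x|)).
    by rewrite !nrmE -rmorphM lecR.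
  by rewrite ler_wpM2r// ltW.
have fP : f \in bounded_op_pred H by apply/asboolP; split.
by exists (BoundedOp fP).
Qed.

End Operators.

(** * Self-adjoint, positive and invertible operators *)

Section SelfAdjoint.
Context {R : realType} {H : hilbertType R}.
Implicit Types (x y z : H) (a c : R) (A B T : 'B(H)).

Definition selfadj A := forall x y, rdot (A x) y = rdot x (A y).

Lemma rdot_i x y : rdot ('i *: x) y = - complex.Im (hdot x y).
Proof. by rewrite /rdot hdotZl; case: (hdot x y) => a b /=; lra. Qed.

Lemma rdot_iC x y : rdot ('i *: x) y = - rdot ('i *: y) x.
Proof. by rewrite !rdot_i hdotC; case: (hdot y x). Qed.

Lemma rdot_ii x y : rdot ('i *: x) ('i *: y) = rdot x y.
Proof.
by rewrite rdot_iC scalerA -expr2 sqr_i scaleN1r rdotNl opprK rdotC.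
Qed.

Lemma quad0_polar T x y :
  (forall z, rdot (T z) z = 0) -> rdot (T x) y = - rdot (T y) x.
Proof.
move=> T0; have := T0 (x + y).
by rewrite bopD !rdotE !T0 => e; lra.
Qed.

(** If [hdot (A x) x] is always real, then ['i *: A] has vanishing real form; polarising that form
    at [x] and ['i *: y] yields the symmetry of [A]. *)
Lemma positive_opP A :
  positive_op A <-> selfadj A /\ forall x, 0 <= rdot (A x) x.
Proof.
split=> [A0|[Asa A0] x]; last first.
  rewrite lecE A0 andbT -[_ == _]/(complex.Im (hdot (A x) x) == 0).
  have e := rdot_iC (A x) x; have := rdot_i (A x) x.
  by move: e; rewrite -Asa bopZ => e h; apply/eqP; lra.
split=> [x y|x]; last by have := A0 x; rewrite lecE => /andP[].
have iA0 z : rdot (('i *: A) z) z = 0.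
  by rewrite scaleopE rdot_i; have := A0 z; rewrite lecE => /andP[/eqP-> _];
    rewrite oppr0.
have := quad0_polar x ('i *: y) iA0.
rewrite !opE rdot_ii => ->.
by rewrite -rdot_iC bopZ rdot_ii.
Qed.

Lemma selfadjD A B : selfadj A -> selfadj B -> selfadj (A + B).
Proof. by move=> a b x y; rewrite !opE !rdotE a b. Qed.

Lemma selfadjN A : selfadj A -> selfadj (- A).
Proof. by move=> a x y; rewrite !opE !rdotE a. Qed.

Lemma selfadjB A B : selfadj A -> selfadj B -> selfadj (A - B).
Proof. by move=> a b; apply: selfadjD => //; exact: selfadjN. Qed.

Lemma selfadjZ c A : selfadj A -> selfadj (c%:C *: A).
Proof. by move=> a x y; rewrite !opE !rdotE a. Qed.

Lemma selfadj0 : selfadj 0.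
Proof. by move=> x y; rewrite !opE rdot0l rdot0r. Qed.

Lemma selfadjM A B : selfadj A -> selfadj B -> A * B = B * A -> selfadj (A * B).
Proof. by move=> a b AB x y; rewrite opE a b -mulopE -AB. Qed.

Lemma selfadj_conj A B : selfadj A -> selfadj B -> selfadj (A * B * A).
Proof. by move=> a b x y; rewrite !opE a b a. Qed.

Lemma selfadj_sum (I : Type) (r : seq I) (P : pred I) (F : I -> 'B(H)) :
  (forall i, selfadj (F i)) -> selfadj (\sum_(i <- r | P i) F i).
Proof. by move=> h; elim/big_ind : _ => //; [exact: selfadj0 | exact: selfadjD]. Qed.

Lemma positive_selfadj A : positive_op A -> selfadj A.
Proof. by move=> /positive_opP[]. Qed.

Lemma pos_inv_selfadj A : pos_inv A -> selfadj A.
Proof. by move=> [/positive_selfadj]. Qed.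

Lemma leop_quad A B x : A <=op B -> rdot (A x) x <= rdot (B x) x.
Proof. by move=> /positive_opP[_ /(_ x)]; rewrite !opE !rdotE subr_ge0. Qed.

Lemma quad_leop A B : selfadj A -> selfadj B ->
  (forall x, rdot (A x) x <= rdot (B x) x) -> A <=op B.
Proof.
move=> a b AB; apply/positive_opP; split; first exact: selfadjB.
by move=> x; rewrite !opE !rdotE subr_ge0.
Qed.

Lemma leop_trans A B T : A <=op B -> B <=op T -> A <=op T.
Proof.
rewrite /loewner_le => /positive_opP[a AB] /positive_opP[b BT].
rewrite -[T - A](subrKA B); apply/positive_opP; split; first exact: selfadjD.
by move=> x; rewrite addopE rdotE addr_ge0.
Qed.

Lemma psd_cauchy_schwarz A x y : selfadj A -> (forall x, 0 <= rdot (A x) x) ->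
  rdot (A x) y ^+ 2 <= rdot (A x) x * rdot (A y) y.
Proof.
move=> a A0; set p := rdot (A x) x; set q := rdot (A y) y; set b := rdot (A x) y.
have h s t : 0 <= s ^+ 2 * p + 2 * s * t * b + t ^+ 2 * q.
  apply: le_trans (A0 (s%:C *: x + t%:C *: y)) _.
  by rewrite !(bopD, bopZ) !rdotE (a y x) (rdotC y) -/p -/q -/b; lra.
have [q0|q0] := eqVneq q 0.
  rewrite q0 mulr0; have [->|b0] := eqVneq b 0; first by rewrite expr0n.
  (* With [q = 0] the form is affine in [t], and this choice makes it [- b ^+ 2]. *)
  by have := h b (- (p + 1) / 2); rewrite q0; have := sqr_ge0 b; nra.
have qp : 0 < q by rewrite lt_neqAle eq_sym q0 /q A0.
have := h q (- b); have -> : q ^+ 2 * p + 2 * q * - b * b + (- b) ^+ 2 * q = q * (p * q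
  - b ^+ 2) by ring.
by rewrite pmulr_rge0// subr_ge0.
Qed.

(** For a self-adjoint operator the numerical radius bounds the norm: subtracting the forms at
    [x + y] and [x - y] bounds [rdot (T x) y], and the best [y] is the multiple of [T x] having the
    norm of [x]. *)
Lemma selfadj_norm_le T c : selfadj T ->
  (forall x, rdot (T x) x <= c * rdot x x) ->
  (forall x, - c * rdot x x <= rdot (T x) x) ->
  forall x, nrm (T x) <= c * nrm x.
Proof.
move=> a Tc cT x; have [T0|T0] := eqVneq (nrm (T x)) 0.
  have [x0|x0] := eqVneq (nrm x) 0; first by rewrite T0 x0 mulr0.
  rewrite T0; apply: mulr_ge0 (nrm_ge0 _).
  have := le_trans (cT x) (Tc x).
  have : 0 < rdot x x by rewrite -sqr_nrm exprn_gt0// lt_neqAle eq_sym x0 nrm_ge0.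
  nra.
have Tp : 0 < nrm (T x) by rewrite lt_neqAle eq_sym T0 nrm_ge0.
have h y : 2 * rdot (T x) y <= c * (rdot x x + rdot y y).
  have := Tc (x + y); have := cT (x - y).
  by rewrite !(bopD, bopN) !rdotE (a y x) (rdotC y x) (rdotC y (T x)); lra.
have xp : 0 < nrm x.
  rewrite lt_neqAle nrm_ge0 andbT; apply: contra T0 => /eqP/esym/nrm0_eq0->.
  by rewrite bop0 nrm0.
have := h ((nrm x / nrm (T x))%:C *: T x); rewrite !rdotE -!sqr_nrm.
have -> : nrm x / nrm (T x) * (nrm x / nrm (T x) * nrm (T x) ^+ 2) = nrm x ^+ 2.
  by field.
have -> : nrm x / nrm (T x) * nrm (T x) ^+ 2 = nrm x * nrm (T x) by field.
nra.
Qed.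

End SelfAdjoint.

(** * Completeness of the bounded operators in norm *)

Section Completeness.
Context {R : realType} {H : hilbertType R}.
Implicit Types (x y z : H) (a c : R) (A B T : 'B(H)).

Lemma nrm_le_eps_eq0 x :
  (forall e : R, 0 < e -> nrm x <= e) -> x = 0.
Proof.
move=> h; apply: nrm0_eq0; apply/eqP; rewrite eq_le nrm_ge0 andbT.
by apply/ler_addgt0Pl => e /h; rewrite addr0.
Qed.

Lemma hilbert_cauchy (u : nat -> H) :
  (forall e : R, 0 < e -> exists N, forall n, (N <= n)%N -> nrm (u n - u N) <= e) ->
  exists l, forall e : R, 0 < e ->
    exists N, forall n, (N <= n)%N -> nrm (u n - l) <= e.
Proof.
move=> hu; have : cvg (u @ \oo)%classic.
  apply: cauchy_cvg; apply: cauchy_exP => e e0.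
  have eR : e = (complex.Re e)%:C by rewrite RRe_real// gtr0_real.
  have e0' : 0 < complex.Re e / 2 by rewrite divr_gt0// -ltcR -eR.
  have [N hN] := hu _ e0'; exists (u N); exists N => // n /= Nn.
  rewrite -ball_normE /= nrmE eR ltcR nrm_sub.
  by apply: le_lt_trans (hN _ Nn) _; rewrite ltr_pdivrMr// ltr_pMr ?ltr1n// -ltcR -eR.
move=> /cvg_ex[l /cvgrPdist_le ul]; exists l => e e0.
have [|N _ hN] := ul e%:C; first by rewrite ltcR.
by exists N => n /hN /=; rewrite nrmE lecR nrm_sub.
Qed.

Lemma nrmZc (k : R[i]) x : nrm (k *: x) = complex.Re `|k| * nrm x.
Proof.
by rewrite /nrm normrZ -{1}[`|k|]RRe_real ?normr_real// ReZ.
Qed.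

(** The pointwise limit inherits the rate [e_], and its distance to [T_ 0] makes it bounded. The
    explicit rate takes the place of an operator norm. *)
Lemma bop_complete (T_ : nat -> 'B(H)) (e_ : nat -> R) :
  (forall n k x, (n <= k)%N -> nrm (T_ k x - T_ n x) <= e_ n * nrm x) ->
  (forall e, 0 < e -> exists N, forall n, (N <= n)%N -> e_ n <= e) ->
  exists T, forall n x, nrm (T x - T_ n x) <= e_ n * nrm x.
Proof.
move=> hT he.
have small e x : 0 < e -> exists N, forall n, (N <= n)%N -> e_ n * nrm x <= e.
  move=> e0; have [|N hN] := he (e / (nrm x + 1)).
    by rewrite divr_gt0// ltr_wpDl// nrm_ge0.
  exists N => n /hN; rewrite ler_pdivlMr ?ltr_wpDl ?nrm_ge0// => h.
  by have := nrm_ge0 x; have [] := leP 0 (e_ n); nra.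
have /boolp.choice[f hf] x : exists l, forall e : R, 0 < e ->
    exists N, forall n, (N <= n)%N -> nrm (T_ n x - l) <= e.
  apply: hilbert_cauchy => e /(small _ x)[N hN].
  by exists N => n Nn; apply: le_trans (hT _ _ _ Nn) (hN _ (leqnn _)).
have hfT n x : nrm (f x - T_ n x) <= e_ n * nrm x.
  apply/ler_addgt0Pl => e /(hf x)[N hN].
  rewrite -(subrKA (T_ (maxn N n) x)); apply: le_trans (ler_nrmD _ _) _.
  by rewrite lerD ?hT ?leq_maxr// nrm_sub hN ?leq_maxl.
have fl : linear f.
  move=> k x y; apply/eqP; rewrite -subr_eq0; apply/eqP/nrm_le_eps_eq0 => e e0.
  have k0 : 0 <= complex.Re `|k| by rewrite -ler0c RRe_real ?normr_real.
  have e3 : 0 < e / 3 by lra.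
  have e4 : 0 < e / 3 / (complex.Re `|k| + 1) by rewrite divr_gt0//; lra.
  have [N1 h1] := small _ (k *: x + y) e3.
  have [N2 h2] := small _ x e4; have [N3 h3] := small _ y e3.
  pose n := maxn N1 (maxn N2 N3).
  have -> : f (k *: x + y) - (k *: f x + f y) =
      (f (k *: x + y) - T_ n (k *: x + y)) + (- (k *: (f x - T_ n x)) - (f y - T_ n y)).
    by rewrite bopD bopZ scalerBr !opprB (addrACA (k *: T_ n x)) subrKA opprD.
  apply: le_trans (ler_nrmD _ _) _; rewrite [e](_ : _ = e / 3 + (e / 3 + e / 3));
    last by lra.
  apply: lerD; first by apply: le_trans (hfT _ _) (h1 _ _); rewrite leq_maxl.
  apply: le_trans (ler_nrmD _ _) _; rewrite !nrmN; apply: lerD; last first.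
    by apply: le_trans (hfT _ _) (h3 _ _); rewrite /n !leq_max leqnn !orbT.
  rewrite nrmZc; apply: (@le_trans _ _ (complex.Re `|k| * (e / 3 / (complex.Re `|k| +
    1)))).
    by rewrite ler_wpM2l//; apply: le_trans (hfT _ _) (h2 _ _);
      rewrite /n !leq_max leqnn !orbT.
  rewrite mulrA ler_pdivrMr; last by lra.
  by rewrite mulrC ler_wpM2l//; lra.
have [c c0 hc] := bop_bounded (T_ 0%N).
have [|T hTf] := @mk_bop _ _ f (e_ 0%N + c) fl.
  move=> x; rewrite -[f x](subrK (T_ 0%N x)); apply: le_trans (ler_nrmD _ _) _.
  by rewrite mulrDl lerD.
by exists T => n x; rewrite hTf.
Qed.

End Completeness.

(** * Neumann series, and invertibility from bounds on the quadratic form *)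

Section Invertibility.
Context {R : realType} {H : hilbertType R}.
Implicit Types (x y z : H) (a c : R) (A B T D : 'B(H)).

Lemma nrm_exp_le D q x n : 0 <= q -> (forall x, nrm (D x) <= q * nrm x) ->
  nrm ((D ^+ n) x) <= q ^+ n * nrm x.
Proof.
move=> q0 Dq; elim: n x => [|n IH] x; first by rewrite !expr0 mul1r.
rewrite exprSr mulopE exprSr -mulrA; apply: le_trans (IH _) _.
by rewrite ler_wpM2l// exprn_ge0.
Qed.

Lemma expr_small (q c : R) : 0 <= q -> q < 1 -> 0 <= c ->
  forall e, 0 < e -> exists N, forall n, (N <= n)%N -> q ^+ n * c <= e.
Proof.
move=> q0 q1 c0 e e0.
have /cvgrPdist_le /(_ (e / (c + 1))) [|N _ hN] : (GRing.exp q @ \oo --> 0)%classic.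
- by apply: cvg_expr; rewrite ger0_norm.
- by rewrite divr_gt0//; lra.
exists N => n /hN /=; rewrite sub0r normrN ger0_norm ?exprn_ge0//.
by rewrite ler_pdivlMr; [move=> h; have := exprn_ge0 n q0; nra | lra].
Qed.

Lemma neumann D q : 0 <= q -> q < 1 -> (forall x, nrm (D x) <= q * nrm x) ->
  invertible_op (1 - D).
Proof.
move=> q0 q1 Dq.
pose S n : 'B(H) := \sum_(i < n) D ^+ i.
have SS n : S n.+1 = S n + D ^+ n by rewrite /S big_ord_recr.
have SD n : S n * (1 - D) = 1 - D ^+ n.
  elim: n => [|n IH]; first by rewrite /S big_ord0 mul0r expr0 subrr.
  by rewrite SS mulrDl IH mulrBr mulr1 -exprSr addrA subrK.
have DS n : (1 - D) * S n = 1 - D ^+ n.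
  elim: n => [|n IH]; first by rewrite /S big_ord0 mulr0 expr0 subrr.
  by rewrite SS mulrDr IH mulrBl mul1r -exprS addrA subrK.
have q1' : 0 < 1 - q by lra.
have hS n k x : (n <= k)%N -> nrm (S k x - S n x) <= q ^+ n * (1 - q)^-1 * nrm x.
  move=> nk; apply: (@le_trans _ _ ((q ^+ n - q ^+ k) / (1 - q) * nrm x)); last first.
    by rewrite !ler_wpM2r ?nrm_ge0 ?invr_ge0 ?(ltW q1')// gerBl exprn_ge0.
  rewrite -(subnK nk); elim: (k - n)%N => [|m IH].
    by rewrite add0n !subrr nrm0 mul0r mul0r.
  rewrite addSn SS addopE addrAC; apply: le_trans (ler_nrmD _ _) _.
  apply: le_trans (lerD IH (nrm_exp_le _ _ q0 Dq)) _.
  by rewrite -mulrDl ler_wpM2r ?nrm_ge0// exprS le_eqVlt; apply/orP; left; apply/eqP;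
    field; lra.
have [||T hT] := @bop_complete _ _ S (fun n => q ^+ n * (1 - q)^-1).
- exact: hS.
- by apply: expr_small => //; rewrite invr_ge0 ltW.
have nD x : nrm ((1 - D) x) <= 2 * nrm x.
  rewrite !opE; apply: le_trans (ler_nrmD _ _) _; rewrite nrmN.
  by have := Dq x; have := nrm_ge0 x; nra.
have small x e : 0 < e -> exists n,
    q ^+ n * nrm x <= e / 2 /\ q ^+ n * (1 - q)^-1 * nrm x <= e / 4.
  move=> e0; have [|N1 h1] := expr_small q0 q1 (nrm_ge0 x) (e := e / 2); first lra.
  have [||N2 h2] := expr_small q0 q1 (c := (1 - q)^-1 * nrm x) _ (e := e / 4).
  - by rewrite mulr_ge0 ?nrm_ge0 ?invr_ge0 ?ltW.
  - by lra.
  by exists (maxn N1 N2); split; [apply: h1; rewrite leq_maxl | rewrite -mulrA;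
    apply: h2; rewrite leq_maxr].
exists T; split; apply: bop_ext => x; rewrite mulopE oneopE.
- apply/eqP; rewrite -subr_eq0; apply/eqP/nrm_le_eps_eq0 => e /(small x)[n [h1 h2]].
  have -> : (1 - D) (T x) - x = (1 - D) (T x - S n x) + - (D ^+ n) x.
    rewrite bopD bopN -[(1 - D) (S n x)]mulopE DS !opE.
    by rewrite -[RHS]addrA -opprD subrK.
  apply: le_trans (ler_nrmD _ _) _; rewrite nrmN.
  by have := nrm_exp_le x n q0 Dq; have := nD (T x - S n x); have := hT n x; lra.
- apply/eqP; rewrite -subr_eq0; apply/eqP/nrm_le_eps_eq0 => e /(small x)[n [h1 h2]].
  have -> : T ((1 - D) x) - x = (T ((1 - D) x) - S n ((1 - D) x)) + - (D ^+ n) x.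
    by rewrite -[S n _]mulopE SD !opE -[RHS]addrA -opprD subrK.
  apply: le_trans (ler_nrmD _ _) _; rewrite nrmN.
  have := nrm_exp_le x n q0 Dq; have := hT n ((1 - D) x).
  have : q ^+ n * (1 - q)^-1 * nrm ((1 - D) x) <= q ^+ n * (1 - q)^-1 * (2 * nrm x).
    apply: ler_wpM2l (nD x); apply: mulr_ge0; first exact: exprn_ge0.
    by rewrite invr_ge0 ltW.
  lra.
Qed.

Lemma lower_bounded_invertible T c : selfadj T -> 0 < c ->
  (forall x, c * rdot x x <= rdot (T x) x) -> invertible_op T.
Proof.
move=> a c0 cT; have [b b0 Tb] := bop_bounded T.
pose d := Num.max b c; have d0 : 0 < d by rewrite lt_max b0.
have dT x : rdot (T x) x <= d * rdot x x.
  apply: le_trans (ler_norm _) _; apply: le_trans (rdot_le_nrm _ _) _.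
  rewrite -sqr_nrm expr2 mulrA ler_wpM2r ?nrm_ge0//; apply: le_trans (Tb x) _.
  by rewrite ler_wpM2r ?nrm_ge0// le_max lexx.
have cd : c <= d by rewrite le_max lexx orbT.
(* Since [c <= T <= d] in the sense of forms, that of [D] lies between [0] and [1 - c / d < 1], so
   the Neumann series inverts [T / d]. *)
pose D : 'B(H) := 1 - d^-1%:C *: T.
have [B [TB BT]] : invertible_op (1 - D).
  apply: (@neumann _ (1 - c / d)); first by rewrite subr_ge0 ler_pdivrMr// mul1r.
    by rewrite gtrBl divr_gt0.
  apply: selfadj_norm_le => [|x|x]; first by apply: selfadjB => //; exact: selfadjZ.
  - rewrite !opE !rdotE -subr_ge0; have := cT x.
    rewrite -(ler_pM2l (x := d^-1)) ?invr_gt0//; lra.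
  - rewrite !opE !rdotE; have := dT x; rewrite -(ler_pM2l (x := d^-1)) ?invr_gt0//.
    rewrite mulKf ?gt_eqF//; have : c / d * rdot x x <= 1 * rdot x x.
      by rewrite ler_wpM2r ?rdot_ge0// ler_pdivrMr// mul1r.
    lra.
have dE : 1 - D = d^-1%:C *: T by rewrite /D opprB addrC subrK.
exists (d^-1%:C *: B); split; apply: bop_ext => x; rewrite !opE.
- by have := congr1 (fun S : 'B(H) => S x) TB; rewrite dE !opE bopZ.
- by have := congr1 (fun S : 'B(H) => S x) BT; rewrite dE !opE bopZ.
Qed.

Lemma inv_opP A : invertible_op A -> A * inv_op A = 1 /\ inv_op A * A = 1.
Proof. by move=> [B AB]; apply: (@xgetPex _ 0 [set B | is_inverse A B]%classic);
  exists B. Qed.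

Lemma inv_op_eq A B : A * B = 1 -> B * A = 1 -> inv_op A = B.
Proof.
move=> AB BA; have [_ h] := @inv_opP A (ex_intro _ B (conj AB BA)).
by rewrite -[LHS]mulr1 -AB mulrA h mul1r.
Qed.

Lemma pos_inv_bounds A : pos_inv A -> exists c d, [/\ 0 < c, 0 < d,
  forall x, c * rdot x x <= rdot (A x) x & forall x, rdot (A x) x <= d * rdot x x].
Proof.
move=> [/positive_opP[a A0] [B [AB BA]]].
have [d d0 Ad] := bop_bounded A; have [b b0 Bb] := bop_bounded B.
have dA x : rdot (A x) x <= d * rdot x x.
  apply: le_trans (ler_norm _) _; apply: le_trans (rdot_le_nrm _ _) _.
  by rewrite -sqr_nrm expr2 mulrA ler_wpM2r ?nrm_ge0.
(* The lower constant combines [nrm x <= b * nrm (A x)], from the inverse, with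
   [nrm (A x) ^+ 2 <= d * rdot (A x) x], which is Cauchy-Schwarz for the form of [A] at [x] and
   [A x]. *)
exists (b ^+ 2 * d)^-1, d; split=> // [|x]; first by rewrite invr_gt0 mulr_gt0 ?exprn_gt0.
rewrite ler_pdivrMl ?mulr_gt0 ?exprn_gt0//.
have h : rdot (A x) (A x) <= d * rdot (A x) x.
  have := psd_cauchy_schwarz x (A x) a A0.
  have := dA (A x); have := rdot_ge0 (A x); have := A0 x.
  set p := rdot (A x) (A x); set q := rdot (A x) x; set s := rdot (A (A x)) (A x).
  move=> q0 p0 sp ps; have [p_eq0|p_neq0] := eqVneq p 0;
    first by rewrite p_eq0 mulr_ge0// ltW.
  have pp : 0 < p by rewrite lt_neqAle eq_sym p_neq0.
  by rewrite -(ler_pM2l pp) -expr2; apply: le_trans ps _; nra.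
have : nrm x ^+ 2 <= (b * nrm (A x)) ^+ 2.
  by rewrite ler_pXn2r ?nnegrE ?mulr_ge0 ?nrm_ge0 ?(ltW b0)// -{1}[x]oneopE -BA mulopE.
rewrite exprMn !sqr_nrm => /le_trans; apply.
by rewrite -[leRHS]mulrA ler_wpM2l// exprn_ge0// ltW.
Qed.

Lemma bounds_pos_inv A c : selfadj A -> 0 < c ->
  (forall x, c * rdot x x <= rdot (A x) x) -> pos_inv A.
Proof.
move=> a c0 cA; split; last exact: lower_bounded_invertible c0 cA.
apply/positive_opP; split=> // x; apply: le_trans (cA x).
by rewrite mulr_ge0 ?rdot_ge0 ?ltW.
Qed.

End Invertibility.

(** * Polynomials of an operator and its spectrum *)

Section Spectrum.
Context {R : realType} {H : hilbertType R}.
Implicit Types (x y z : H) (a c : R) (A B T D : 'B(H)) (q : {poly R[i]}) (p : {poly R}).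

Lemma scalemulopl (k : R[i]) A B : k *: A * B = k *: (A * B).
Proof. by apply: bop_ext. Qed.

Lemma scalemulopr (k : R[i]) A B : A * (k *: B) = k *: (A * B).
Proof. by apply: bop_ext => x; rewrite !opE bopZ. Qed.

Definition cpoly_op q A : 'B(H) := \sum_(i < size q) q`_i *: A ^+ i.

Lemma cpoly_op_wide n q A : (size q <= n)%N ->
  cpoly_op q A = \sum_(i < n) q`_i *: A ^+ i.
Proof.
move=> qn; rewrite /cpoly_op (big_ord_widen n (fun i => q`_i *: A ^+ i) qn).
rewrite big_mkcond; apply: eq_bigr => i _; case: ltnP => // /(nth_default 0) ->.
by rewrite scale0r.
Qed.

Lemma cpoly_opD q1 q2 A : cpoly_op (q1 + q2) A = cpoly_op q1 A + cpoly_op q2 A.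
Proof.
rewrite !(@cpoly_op_wide (maxn (size q1) (size q2))) ?leq_maxl ?leq_maxr ?size_polyD//.
by rewrite -big_split; apply: eq_bigr => i _; rewrite coefD scalerDl.
Qed.

Lemma cpoly_opC (k : R[i]) A : cpoly_op k%:P A = k *: (1 : 'B(H)).
Proof.
by rewrite (@cpoly_op_wide 1%N) ?size_polyC_leq1// big_ord1 coefC expr0.
Qed.

Lemma cpoly_opZ (k : R[i]) q A : cpoly_op (k *: q) A = k *: cpoly_op q A.
Proof.
rewrite (@cpoly_op_wide (size q)) ?size_scale_leq// scaler_sumr.
by apply: eq_bigr => i _; rewrite coefZ scalerA.
Qed.

Lemma cpoly_opMX q A : cpoly_op (q * 'X) A = cpoly_op q A * A.
Proof.
rewrite (@cpoly_op_wide (size q).+1); last first.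
  by rewrite (leq_trans (size_polyMleq _ _))// size_polyX addnC.
rewrite big_ord_recl coefMX /= scale0r add0r mulr_suml.
by apply: eq_bigr => i _; rewrite coefMX /= exprSr scalemulopl.
Qed.

Lemma cpoly_op_comm q A : cpoly_op q A * A = A * cpoly_op q A.
Proof.
rewrite mulr_suml mulr_sumr; apply: eq_bigr => i _.
by rewrite scalemulopl scalemulopr -exprS -exprSr.
Qed.

Lemma cpoly_opM q1 q2 A : cpoly_op (q1 * q2) A = cpoly_op q1 A * cpoly_op q2 A.
Proof.
elim/poly_ind: q1 => [|q1 k IH].
  by rewrite mul0r -[0]/(0%:P) cpoly_opC scale0r mul0r.
rewrite mulrDl mulrAC mul_polyC !cpoly_opD !cpoly_opMX cpoly_opZ IH cpoly_opC.
by rewrite mulrDl scalemulopl mul1r -!mulrA cpoly_op_comm.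
Qed.

Lemma cpoly_opX A : cpoly_op 'X A = A.
Proof. by rewrite -['X]mul1r cpoly_opMX -[1]/(1%:P) cpoly_opC scale1r mul1r. Qed.

Lemma cpoly_op_XsubC (k : R[i]) A : cpoly_op ('X - k%:P) A = A - k *: (1 : 'B(H)).
Proof. by rewrite -polyCN cpoly_opD cpoly_opX cpoly_opC scaleNr. Qed.

Lemma invertibleM A B : invertible_op A -> invertible_op B -> invertible_op (A * B).
Proof.
move=> [A' [h1 h2]] [B' [h3 h4]]; exists (B' * A'); split.
- by rewrite mulrA -(mulrA A) h3 mulr1.
- by rewrite mulrA -(mulrA B') h2 mulr1.
Qed.

Lemma invertible_scale (k : R[i]) A : k != 0 -> invertible_op A -> invertible_op (k *: A).
Proof.
move=> k0 [B [AB BA]]; exists (k^-1 *: B); split.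
- by rewrite scalemulopl scalemulopr scalerA divff// scale1r.
- by rewrite scalemulopl scalemulopr scalerA mulVf// scale1r.
Qed.

Lemma invertible1 : invertible_op (1 : 'B(H)).
Proof. by exists 1; split; rewrite mulr1. Qed.

Lemma comm_invertible A B : A * B = B * A -> invertible_op (A * B) -> invertible_op A.
Proof.
move=> AB [D [h1 h2]]; exists (B * D); split; first by rewrite mulrA.
have BA : D * B * A = 1 by rewrite -mulrA -AB.
suff -> : B * D = D * B by [].
by rewrite -[LHS]mul1r -BA mulrA -!mulrA (mulrA A) h1 mulr1.
Qed.

(** One half of spectral mapping: over [R[i]] the polynomial splits into linear factors, and a
    product of invertible operators [A - z] would be invertible. *)
Lemma spectral_root q A : q != 0 -> ~ invertible_op (cpoly_op q A) ->
  exists2 z, root q z & spectrum A z.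
Proof.
move=> q0; have [r ->] := closed_field_poly_normal q.
have: lead_coef q != 0 by rewrite lead_coef_eq0.
move: (lead_coef q) => k k0; rewrite cpoly_opZ => h.
have {h}: ~ invertible_op (cpoly_op (\prod_(z <- r) ('X - z%:P)) A).
  by move=> h'; apply: h; exact: invertible_scale.
elim: r => [|z r IH] h.
  by case: h; rewrite big_nil -[1]/(1%:P) cpoly_opC scale1r; exact: invertible1.
have [hz|/contrapT hz] := pselect (spectrum A z).
  by exists z => //; rewrite rootZ// big_cons rootM root_XsubC eqxx.
have [|w rw sw] := IH.
  move=> h'; apply: h; rewrite big_cons cpoly_opM cpoly_op_XsubC.
  exact: invertibleM.
by exists w => //; move: rw; rewrite !rootZ// big_cons rootM => ->; rewrite orbT.
Qed.

(** For [z = s + i t], the product of [A - z] with [A] minus the conjugate of [z] is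
    [(A - s)^2 + t^2], which is bounded below by [t^2]. *)
Lemma spectrum_real A (z : R[i]) : selfadj A -> spectrum A z -> z = (complex.Re z)%:C.
Proof.
case: z => s t a sp; have [->//|t0] := eqVneq t 0; case: sp.
have E : (A - (s +i* t) *: (1 : 'B(H))) * (A - (s -i* t) *: (1 : 'B(H))) =
    (A - s%:C *: (1 : 'B(H))) * (A - s%:C *: (1 : 'B(H))) + (t ^+ 2)%:C *: (1 : 'B(H)).
  have sq : ((t ^+ 2)%:C)%:P = - (((t *i)%C)%:P * ((t *i)%C)%:P) :> {poly R[i]}.
    rewrite -polyCM -polyCN; congr _%:P; apply/eqP; rewrite eq_complex /=.
    by apply/andP; split; apply/eqP; ring.
  have zE : (s +i* t)%:P = (s%:C)%:P + ((t *i)%C)%:P :> {poly R[i]}.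
    by rewrite -polyCD; congr _%:P; apply/eqP; rewrite eq_complex /= addr0 add0r !eqxx.
  have wE : (s -i* t)%:P = (s%:C)%:P - ((t *i)%C)%:P :> {poly R[i]}.
    by rewrite -polyCN -polyCD; congr _%:P; apply/eqP;
      rewrite eq_complex /= oppr0 addr0 add0r !eqxx.
  rewrite -!cpoly_op_XsubC -!cpoly_opM -(cpoly_opC _ A) -cpoly_opD; congr cpoly_op.
  by rewrite sq zE wE; ring.
apply: (@comm_invertible _ (A - (s -i* t) *: (1 : 'B(H))));
  first by rewrite -!cpoly_op_XsubC -!cpoly_opM mulrC.
have sa : selfadj (A - s%:C *: (1 : 'B(H))) by apply: selfadjB => //; exact: selfadjZ.
rewrite E; apply: (@lower_bounded_invertible _ _ _ (t ^+ 2)).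
- by apply: selfadjD; [exact: selfadjM | exact: selfadjZ].
- by rewrite exprn_even_gt0.
- by move=> x; rewrite addopE rdotDl mulopE sa scaleopE rdotZl lerDr rdot_ge0.
Qed.

Lemma selfadj_spectrum_ge A c t : selfadj A ->
  (forall x, c * rdot x x <= rdot (A x) x) -> spectrum A t%:C -> c <= t.
Proof.
move=> a cA sp; rewrite leNgt; apply/negP => tc; apply: sp.
apply: (@lower_bounded_invertible _ _ _ (c - t)); last 2 first.
- by rewrite subr_gt0.
- by move=> x; rewrite !opE !rdotE mulrBl lerB.
by apply: selfadjB => //; exact: selfadjZ.
Qed.

Lemma selfadj_spectrum_le A c t : selfadj A ->
  (forall x, rdot (A x) x <= c * rdot x x) -> spectrum A t%:C -> t <= c.
Proof.
move=> a cA sp; rewrite leNgt; apply/negP => tc; apply: sp.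
rewrite -opprB -scaleN1r; apply: invertible_scale; first by rewrite oppr_eq0 oner_eq0.
apply: (@lower_bounded_invertible _ _ _ (t - c)); last 2 first.
- by rewrite subr_gt0.
- by move=> x; rewrite !opE !rdotE mulrBl lerB.
by apply: selfadjB => //; exact: selfadjZ.
Qed.

(* [l] is the infimum of the numerical range of [T]. *)
Lemma numerical_range_inf T x : selfadj T -> rdot (T x) x < 0 ->
  exists2 l : R, l < 0 & spectrum T l%:C.
Proof.
move=> a Tx0; have [b b0 Tb] := bop_bounded T.
pose D := [set c : R | forall y, c * rdot y y <= rdot (T y) y]%classic.
have xp : 0 < rdot x x.
  rewrite lt_neqAle rdot_ge0 andbT; apply/negP => /eqP/esym/rdot_eq0 x0.
  by move: Tx0; rewrite x0 bop0 rdot0l ltxx.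
have Dub : ubound D (rdot (T x) x / rdot x x).
  by move=> c /(_ x); rewrite ler_pdivlMr.
have D0 : has_sup D.
  split; last by exists (rdot (T x) x / rdot x x).
  exists (- b) => y; rewrite mulNr lerNl; apply: le_trans (ler_norm _) _.
  rewrite normrN; apply: le_trans (rdot_le_nrm _ _) _.
  by rewrite -sqr_nrm expr2 mulrA ler_wpM2r ?nrm_ge0.
have Dsup : D (sup D).
  move=> y; have [/rdot_eq0->|y0] := eqVneq (rdot y y) 0.
    by rewrite bop0 !rdot0l mulr0.
  have yp : 0 < rdot y y by rewrite lt_neqAle eq_sym y0 rdot_ge0.
  rewrite -ler_pdivlMr//; apply: ge_sup; first by case: D0.
  by move=> c /(_ y); rewrite ler_pdivlMr.
exists (sup D).
  apply: (@le_lt_trans _ _ (rdot (T x) x / rdot x x));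
    last by rewrite pmulr_llt0 ?invr_gt0.
  by apply: ge_sup => //; case: D0.
(* If [T - sup D] were invertible, its nonnegative form would have a lower bound [e > 0], and
   [sup D + e] would lie in [D]. *)
move=> inv; have sa : selfadj (T - (sup D)%:C *: (1 : 'B(H))).
  by apply: selfadjB => //; exact: selfadjZ.
have [|e [_ [e0 _ eT _]]] := @pos_inv_bounds _ _ (T - (sup D)%:C *: (1 : 'B(H))).
  split=> //; apply/positive_opP; split=> // y.
  by rewrite !opE !rdotE subr_ge0; exact: Dsup.
suff /(ub_le_sup (proj2 D0)) : D (sup D + e) by rewrite gerDl leNgt e0.
move=> y; have := eT y; rewrite !opE !rdotE; lra.
Qed.

Lemma poly_opE p A : poly_op p A = cpoly_op (map_poly (real_complex R) p) A.
Proof.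
rewrite /cpoly_op size_map_poly; apply: eq_bigr => i _.
by rewrite coef_map.
Qed.

Lemma poly_opD p1 p2 A : poly_op (p1 + p2) A = poly_op p1 A + poly_op p2 A.
Proof. by rewrite !poly_opE rmorphD cpoly_opD. Qed.

Lemma poly_opZ (c : R) p A : poly_op (c *: p) A = c%:C *: poly_op p A.
Proof. by rewrite !poly_opE map_polyZ cpoly_opZ. Qed.

Lemma poly_opM p1 p2 A : poly_op (p1 * p2) A = poly_op p1 A * poly_op p2 A.
Proof. by rewrite !poly_opE rmorphM cpoly_opM. Qed.

Lemma poly_opC (c : R) A : poly_op c%:P A = c%:C *: (1 : 'B(H)).
Proof. by rewrite !poly_opE map_polyC cpoly_opC. Qed.

Lemma poly_opX A : poly_op 'X A = A.
Proof. by rewrite !poly_opE map_polyX cpoly_opX. Qed.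

Lemma poly_opB p1 p2 A : poly_op (p1 - p2) A = poly_op p1 A - poly_op p2 A.
Proof. by rewrite -scaleN1r poly_opD poly_opZ rmorphN1 scaleN1r. Qed.

Lemma poly_op_selfadj p A : selfadj A -> selfadj (poly_op p A).
Proof.
move=> a; apply: selfadj_sum => i; apply: selfadjZ.
elim: (i : nat) => [|n IH]; first by rewrite expr0.
by rewrite exprS; apply: selfadjM => //; rewrite -exprS -exprSr.
Qed.

(* A negative spectral value [l] of [p(A)] makes some root of [p - l] a spectral
   value of [A]. *)
Lemma poly_op_psd p A : selfadj A -> (forall t, spectrum A t%:C -> 0 <= p.[t]) ->
  forall x, 0 <= rdot (poly_op p A x) x.
Proof.
move=> a p0 x; rewrite leNgt; apply/negP => hx.
have [l l0] := numerical_range_inf (poly_op_selfadj p a) hx.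
pose q := p - l%:P; have -> : spectrum (poly_op p A) l%:C = 
    ~ invertible_op (cpoly_op (map_poly (real_complex R) q) A).
  by rewrite -poly_opE poly_opB poly_opC.
(* If [p] is the negative constant [l], the contradiction needs some point of the spectrum of [A].
   One exists because [A - (b + 1)] has a negative form at [x]. *)
have [q0|q0] := eqVneq (map_poly (real_complex R) q) 0.
  move=> _; have {}q0 : p = l%:P.
    apply/eqP; rewrite -subr_eq0 -/q; apply/eqP.
    by apply: (map_poly_inj (real_complex R)); rewrite q0 rmorph0.
  have [b b0 Ab] := bop_bounded A.
  have xp : 0 < rdot x x.
    rewrite lt_neqAle rdot_ge0 andbT; apply/negP => /eqP/esym/rdot_eq0 x0.
    by move: hx; rewrite x0 bop0 rdot0l ltxx.
  have [||m m0] := @numerical_range_inf (A - (b + 1)%:C *: (1 : 'B(H))) x.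
  - by apply: selfadjB => //; exact: selfadjZ.
  - rewrite !opE !rdotE subr_lt0; apply: le_lt_trans (ler_norm _) _.
    apply: le_lt_trans (rdot_le_nrm _ _) _.
    apply: (@le_lt_trans _ _ (b * nrm x * nrm x)).
      by rewrite ler_wpM2r ?nrm_ge0.
    by rewrite -mulrA -expr2 sqr_nrm ltr_pM2r//; lra.
  rewrite /spectrum /= -addrA -opprD -scalerDl -rmorphD => /(p0 _).
  by rewrite q0 hornerC leNgt l0.
move=> /(spectral_root q0)[z rz sz].
have zE := spectrum_real a sz; move: rz sz; rewrite zE.
rewrite /root horner_map fmorph_eq0 hornerD hornerN hornerC subr_eq0 => /eqP pz /p0.
by rewrite pz leNgt l0.
Qed.

End Spectrum.

(** * Weierstrass approximation *)

Section Weierstrass.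
Context {R : realType}.
Implicit Types (a b c e t u v : R) (f : R -> R) (p : {poly R}).

(** Phrased with a sequence of predicates so that one compactness argument gives both uniform
    continuity ([n] an inverse radius) and boundedness ([n] the bound). *)
Lemma segment_near_covering a b (P : nat -> R -> Prop) :
  (forall x, x \in `[a, b] -> exists N, exists2 d : R, 0 < d &
     forall n y, (N <= n)%N -> `|x - y| < d -> P n y) ->
  exists n, forall x, x \in `[a, b] -> P n x.
Proof.
move=> h.
have /compact_near_coveringP/(_ nat \oo%classic P _) := @segment_compact _ a b.
case=> [x xab|N _ hN]; last by exists N => x xab; exact: (hN N (leqnn N)).
have [N [d d0 hd]] := h x xab.
exists (ball x d, [set n | (N <= n)%N])%classic.
  by split; [exact: nbhsx_ballx | exists N].
by move=> [y n] [/= yd Nn]; exact: hd.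
Qed.

(** Close points are covered by uniform continuity; at distance at least [1 / (n + 1)] the quadratic
    term alone exceeds twice the bound of [f]. The quadratic shape is what the variance estimate for
    Bernstein polynomials consumes. *)
Lemma segment_quadratic_modulus f a b e : {in `[a, b], continuous f} -> 0 < e ->
  exists2 c : R, 0 <= c & forall x y, x \in `[a, b] -> y \in `[a, b] ->
    `|f x - f y| <= e + c * (x - y) ^+ 2.
Proof.
move=> fc e0.
have loc x (d : R) : x \in `[a, b] -> 0 < d ->
    exists2 r : R, 0 < r & forall y, `|x - y| < r -> `|f x - f y| <= d.
  move=> xab d0; have /cvgrPdist_le/(_ d d0) := fc x xab.
  by move=> /nbhs_ballP[r /= r0 hr]; exists r.
have [n hn] : exists n, forall x, x \in `[a, b] ->
    forall y, `|x - y| < n.+1%:R^-1 -> `|f x - f y| <= e.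
  apply: segment_near_covering => x xab.
  have [|r r0 hr] := loc x (e / 2) xab; first lra.
  have [N hN] : exists N, N.+1%:R^-1 < r / 2.
    by exists (Num.truncn (r / 2)^-1); rewrite invf_plt ?posrE ?divr_gt0// truncnS_gt.
  exists N, (r / 2); first by rewrite divr_gt0.
  move=> n y Nn xy z yz.
  have nr : n.+1%:R^-1 < r / 2.
    by apply: le_lt_trans hN; rewrite lef_pV2 ?posrE ?ltr0n// ler_nat.
  have h1 : `|f x - f y| <= e / 2 by apply: hr; lra.
  have h2 : `|f x - f z| <= e / 2.
    by apply: hr; rewrite -(subrKA y) [ltRHS]splitr;
      apply: le_lt_trans (ler_normD _ _) _; rewrite ltrD// (lt_trans yz).
  rewrite -(subrKA (f x)); apply: le_trans (ler_normD _ _) _.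
  by rewrite (distrC (f y)); lra.
have [k hk] : exists k : nat, forall x, x \in `[a, b] -> `|f x| <= k%:R.
  apply: segment_near_covering => x xab.
  have [|r r0 hr] := loc x 1 xab; first lra.
  exists (Num.truncn (`|f x| + 1)).+1, r => // k y Nk /hr h.
  have h1 : `|f x| + 1 < k%:R by apply: lt_le_trans (truncnS_gt _) _; rewrite ler_nat.
  rewrite -[f y](subKr (f x)); apply: le_trans (ler_normB _ _) _.
  by apply: le_trans (ltW h1); rewrite lerD2l.
exists (2 * k%:R * n.+1%:R ^+ 2) => [|x y xab yab].
  by rewrite !mulr_ge0 ?exprn_ge0.
have [xy|xy] := ltP `|x - y| n.+1%:R^-1.
  apply: le_trans (hn _ xab _ xy) _.
  by rewrite lerDl; apply: mulr_ge0 (sqr_ge0 _); apply: mulr_ge0 (sqr_ge0 _);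
    exact: mulr_ge0.
have : 1 <= n.+1%:R ^+ 2 * (x - y) ^+ 2.
  rewrite -exprMn -real_normK ?num_real// exprn_ege1// normrM ger0_norm//.
  by rewrite -ler_pdivrMl ?mulr1.
have := hk _ xab; have := hk _ yab; have := ler_normB (f x) (f y).
have : 0 <= k%:R :> R by [].
nra.
Qed.

(* The Bernstein polynomial [\sum_k phi k * 'C(n, k) * 'X^k * (1 - 'X)^(n - k)],
   through Pascal's rule. *)
Fixpoint bernstein n (phi : nat -> R) : {poly R} :=
  if n is n'.+1 then
    (1 - 'X) * bernstein n' phi + 'X * bernstein n' (phi \o S)
  else (phi 0%N)%:P.

(** The bracket is the second moment of [S + c] for a binomial variable [S] with parameters [n] and
    [u]: squared mean plus variance. The induction conditions on one trial, whose success shifts [c]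
    by one; hence the free parameter [c]. *)
Lemma bernstein_dist n (phi : nat -> R) u v c k e : 0 <= u <= 1 ->
  (forall j, (j <= n)%N -> `|phi j - v| <= e + k * (j%:R + c) ^+ 2) ->
  `|(bernstein n phi).[u] - v| <=
    e + k * ((n%:R * u + c) ^+ 2 + n%:R * u * (1 - u)).
Proof.
move=> /andP[u0 u1]; elim: n phi c => [|n IH] phi c h /=.
  by rewrite hornerC !mul0r !addr0; exact: h.
have h1 := IH phi c (fun j jn => h j (leqW jn)).
have h2 : `|(bernstein n (phi \o S)).[u] - v| <=
    e + k * ((n%:R * u + (c + 1)) ^+ 2 + n%:R * u * (1 - u)).
  apply: IH => j jn /=; have := h j.+1 jn.
  by rewrite -nat1r (_ : 1 + j%:R + c = j%:R + (c + 1))//; ring.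
rewrite !hornerE.
set E1 := (bernstein n phi).[u] in h1 *; set E2 := (bernstein n _).[u] in h2 *.
have -> : (1 - u) * E1 + u * E2 - v = (1 - u) * (E1 - v) + u * (E2 - v) by ring.
have u1' : 0 <= 1 - u by rewrite subr_ge0.
apply: le_trans (ler_normD _ _) _; rewrite !normrM (ger0_norm u0) (ger0_norm u1').
apply: le_trans (lerD (ler_wpM2l u1' h1) (ler_wpM2l u0 h2)) _.
by rewrite -nat1r le_eqVlt; apply/orP; left; apply/eqP; ring.
Qed.

Theorem weierstrass f a b e : a < b -> {in `[a, b], continuous f} -> 0 < e ->
  exists p, forall t, a <= t <= b -> `|p.[t] - f t| <= e.
Proof.
move=> ab fc e0; have ba0 : 0 < b - a by rewrite subr_gt0.
have [|c c0 hc] := segment_quadratic_modulus (e := e / 2) fc; first lra.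
have [n n0 hn] : exists2 n : nat, 0 < n%:R :> R & c * (b - a) ^+ 2 / n%:R <= e / 2.
  exists (Num.truncn (c * (b - a) ^+ 2 / (e / 2))).+1 => //.
  by rewrite ler_pdivrMr// [leRHS]mulrC -ler_pdivrMr ?divr_gt0// ltW// truncnS_gt.
pose phi k := f (a + (b - a) * (k%:R / n%:R)).
exists (bernstein n phi \Po ((b - a)^-1 *: ('X - a%:P))) => t /andP[at_ tb].
rewrite horner_comp !hornerE; set u := (b - a)^-1 * (t - a).
have u0 : 0 <= u by rewrite mulr_ge0 ?invr_ge0 ?subr_ge0// ltW.
have u1 : u <= 1 by rewrite ler_pdivrMl// mulr1 lerB.
have tE : t = a + (b - a) * u by rewrite /u mulVKf ?gt_eqF// addrC subrK.
(* Centring at the mean [n u] leaves only the variance [n u (1 - u)], which the factor [1 / n ^ 2]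
   from rescaling beats. *)
have B := @bernstein_dist n phi u (f t) (- (n%:R * u)) (c * (b - a) ^+ 2 / n%:R ^+ 2)
  (e / 2).
apply: le_trans (B _ _) _ => [|j jn|]; first by rewrite u0.
- have j0 : 0 <= j%:R / n%:R :> R by exact: divr_ge0.
  have j1 : j%:R / n%:R <= 1 :> R by rewrite ler_pdivrMr// mul1r ler_nat.
  apply: le_trans (hc _ _ _ _) _.
  + by rewrite in_itv /=; apply/andP; split; nra.
  + by rewrite in_itv /= at_.
  rewrite lerD2l {1}tE le_eqVlt; apply/orP; left; apply/eqP; field.
  by rewrite gt_eqF.
- rewrite subrr expr0n /= add0r -[leRHS](_ : e / 2 + e / 2 = _); last by field.
  rewrite lerD2l; apply: le_trans hn.
  have -> : c * (b - a) ^+ 2 / n%:R ^+ 2 * (n%:R * u * (1 - u)) =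
    c * (b - a) ^+ 2 / n%:R * (u * (1 - u)) by field; rewrite gt_eqF.
  apply: ler_piMr; last by nra.
  by apply: mulr_ge0; [exact: mulr_ge0 (sqr_ge0 _) | rewrite invr_ge0 ltW].
Qed.

End Weierstrass.

(** * Continuous functional calculus *)

Section FunctionalCalculus.
Context {R : realType} {H : hilbertType R}.
Implicit Types (x y z : H) (a b c d e t : R) (A B C T : 'B(H)) (f g : R -> R).

Lemma opnorm_leP A c : opnorm_le A c <-> forall x, nrm (A x) <= c * nrm x.
Proof.
by split=> h x; have := h x; rewrite !nrmE -rmorphM lecR.
Qed.

Lemma poly_op_norm_le (p : {poly R}) A c : selfadj A ->
  (forall t, spectrum A t%:C -> `|p.[t]| <= c) ->
  forall x, nrm (poly_op p A x) <= c * nrm x.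
Proof.
move=> a pc; apply: selfadj_norm_le; first exact: poly_op_selfadj.
- move=> x; have : 0 <= rdot (poly_op (c%:P - p) A x) x.
    apply: poly_op_psd => // t /pc; rewrite ler_norml hornerD hornerN hornerC subr_ge0.
    by move=> /andP[].
  by rewrite poly_opB poly_opC !opE !rdotE subr_ge0.
- move=> x; have : 0 <= rdot (poly_op (p + c%:P) A x) x.
    apply: poly_op_psd => // t /pc; rewrite ler_norml hornerD hornerC -lerBlDr sub0r.
    by move=> /andP[].
  by rewrite poly_opD poly_opC !opE !rdotE -lerBlDr sub0r mulNr.
Qed.

(** Two polynomials within [d] of [f] on the spectrum differ there by at most [2 d], so their values
    at [A] differ by at most [2 d] in norm; two more errors [d] lead to [B] and [C]. *)
Lemma cfc_unique f A B C : selfadj A -> is_cfc f A B -> is_cfc f A C -> B = C.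
Proof.
move=> a hB hC; apply: bop_ext => x; apply/eqP; rewrite -subr_eq0; apply/eqP.
apply: nrm_le_eps_eq0 => e e0; pose d := e / (4 * (nrm x + 1)).
have n0 := nrm_ge0 x.
have d0 : 0 < d by rewrite divr_gt0//; lra.
have [p [pf /opnorm_leP pB]] := hB d d0; have [q [qf /opnorm_leP qC]] := hC d d0.
have pq : nrm (poly_op (p - q) A x) <= (d + d) * nrm x.
  apply: poly_op_norm_le => // t st; rewrite hornerD hornerN -(subrKA (f t)).
  by apply: le_trans (ler_normD _ _) _; rewrite lerD ?pf// distrC qf.
have -> : B x - C x = poly_op (p - q) A x - (poly_op p A - B) x + (poly_op q A - C) x.
  by rewrite poly_opB !opE opprB (addrC (poly_op p A x - _)) !subrKA.
apply: le_trans (ler_nrmD _ _) _; apply: le_trans (lerD (ler_nrmD _ _) (lexx _)) _.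
rewrite nrmN; have := pB x; have := qC x => h1 h2.
have : 4 * d * (nrm x + 1) = e by rewrite /d; field; lra.
nra.
Qed.

Lemma is_cfc_ext f g A B : (forall t, spectrum A t%:C -> f t = g t) ->
  is_cfc f A B -> is_cfc g A B.
Proof.
move=> fg h e /h[p [pf pB]]; exists p; split=> // t st.
by rewrite -fg// pf.
Qed.

Lemma is_cfc_poly (p : {poly R}) A : is_cfc (horner p) A (poly_op p A).
Proof.
move=> e e0; exists p; split=> [t _|]; first by rewrite subrr normr0 ltW.
by apply/opnorm_leP => x; rewrite subrr opE nrm0 mulr_ge0 ?nrm_ge0 ?ltW.
Qed.

Lemma is_cfcD f g A B C : is_cfc f A B -> is_cfc g A C ->
  is_cfc (fun t => f t + g t) A (B + C).
Proof.
move=> hB hC e e0; have e2 : 0 < e / 2 by lra.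
have [p [pf /opnorm_leP pB]] := hB _ e2; have [q [qf /opnorm_leP qC]] := hC _ e2.
exists (p + q); split=> [t st|].
  rewrite hornerD opprD addrACA [leRHS]splitr; apply: le_trans (ler_normD _ _) _.
  by rewrite lerD ?pf ?qf.
apply/opnorm_leP => x; rewrite poly_opD opprD addrACA addopE [e]splitr mulrDl.
by apply: le_trans (ler_nrmD _ _) _; rewrite lerD.
Qed.

Lemma is_cfcZ c f A B : is_cfc f A B -> is_cfc (fun t => c * f t) A (c%:C *: B).
Proof.
move=> hB e e0; have c0 := normr_ge0 c.
have d0 : 0 < e / (`|c| + 1) by rewrite divr_gt0//; lra.
have ce : `|c| * (e / (`|c| + 1)) <= e.
  by rewrite mulrA ler_pdivrMr 1?mulrC ?ler_wpM2l; lra.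
have [p [pf /opnorm_leP pB]] := hB _ d0; exists (c *: p); split=> [t st|].
  rewrite hornerZ -mulrBr normrM; apply: le_trans ce.
  by rewrite ler_wpM2l// pf.
apply/opnorm_leP => x; rewrite poly_opZ -scalerBr scaleopE nrmZ.
apply: (@le_trans _ _ (`|c| * (e / (`|c| + 1)) * nrm x)).
  by rewrite -mulrA ler_wpM2l.
by rewrite ler_wpM2r ?nrm_ge0.
Qed.

(** Needed to control products. The spectrum is bounded and [f] stays within [1] of a polynomial on
    it, so continuity of [f] is not invoked. *)
Lemma is_cfc_bounded f A B : selfadj A -> is_cfc f A B ->
  exists2 c, 0 <= c & forall t, spectrum A t%:C -> `|f t| <= c.
Proof.
move=> a hB; have [p [pf _]] := hB 1 ltr01; have [b b0 Ab] := bop_bounded A.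
have At x : `|rdot (A x) x| <= b * rdot x x.
  apply: le_trans (rdot_le_nrm _ _) _.
  by rewrite -sqr_nrm expr2 mulrA ler_wpM2r ?nrm_ge0.
have st t : spectrum A t%:C -> `|t| <= b.
  move=> sp; rewrite ler_norml; apply/andP; split.
    apply: (selfadj_spectrum_ge a _ sp) => x; rewrite mulNr.
    by have := At x; rewrite ler_norml => /andP[].
  by apply: (selfadj_spectrum_le a _ sp) => x; exact: le_trans (ler_norm _) (At x).
have [k k0 hk] : exists2 k, 0 <= k & forall t, `|t| <= b -> `|p.[t]| <= k.
  elim/poly_ind: p {pf} => [|p c [k k0 hk]].
    by exists 0 => // t _; rewrite horner0 normr0.
  exists (k * b + `|c|) => [|t tb]; first by rewrite addr_ge0 ?mulr_ge0 ?(ltW b0).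
  rewrite hornerMXaddC; apply: le_trans (ler_normD _ _) _.
  by rewrite lerD2r normrM ler_pM// hk.
exists (k + 1) => [|t sp]; first by rewrite addr_ge0.
rewrite -[f t](subKr p.[t]); apply: le_trans (ler_normB _ _) _.
by rewrite lerD ?hk ?st ?pf.
Qed.

Lemma is_cfcM f g A B C : selfadj A -> is_cfc f A B -> is_cfc g A C ->
  is_cfc (fun t => f t * g t) A (B * C).
Proof.
move=> a hB hC e e0.
have [F F0 hF] := is_cfc_bounded a hB; have [G G0 hG] := is_cfc_bounded a hC.
have [b b0 Bb] := bop_bounded B; have [c c0 Cc] := bop_bounded C.
(* Chosen to dominate both error factors met below: [F + G + 1] on the spectrum and [b + c + 1] for
   the operators. *)
pose s := F + G + b + c + 1; have s0 : 0 < s by rewrite /s; lra.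
pose d := Num.min 1 (e / s).
have d0 : 0 < d by rewrite lt_min ltr01 divr_gt0.
have d1 : d <= 1 by rewrite ge_min lexx.
have ds : d * s <= e by rewrite -ler_pdivlMr// ge_min lexx orbT.
have [p [pf /opnorm_leP pB]] := hB _ d0; have [q [qf /opnorm_leP qC]] := hC _ d0.
exists (p * q); split=> [t st|].
  rewrite hornerM -(subrKA (f t * q.[t])) -mulrBl -mulrBr.
  apply: le_trans (ler_normD _ _) _; rewrite !normrM.
  have hq : `|q.[t]| <= G + 1.
    rewrite -(subrK (g t) q.[t]); apply: le_trans (ler_normD _ _) _.
    by have := qf _ st; have := hG _ st; lra.
  apply: (@le_trans _ _ (d * (G + 1) + F * d)).
    by apply: lerD; apply: ler_pM => //; [exact: pf | exact: hF | exact: qf].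
  by apply: le_trans ds; rewrite /s; nra.
apply/opnorm_leP => x.
have -> : poly_op (p * q) A - B * C = (poly_op p A - B) * poly_op q A + B * (poly_op q
  A - C).
  by rewrite poly_opM mulrBl mulrBr subrKA.
have x0 := nrm_ge0 x.
have hq : nrm (poly_op q A x) <= (c + 1) * nrm x.
  rewrite -(subrK (C x) (poly_op q A x)); apply: le_trans (ler_nrmD _ _) _.
  by have := qC x; have := Cc x; rewrite !opE; nra.
apply: le_trans (ler_nrmD _ _) _.
apply: (@le_trans _ _ (d * ((c + 1) * nrm x) + b * (d * nrm x))).
  apply: lerD.
    by apply: le_trans (pB _) _; rewrite ler_wpM2l// ltW.
  by apply: le_trans (Bb _) _; rewrite ler_wpM2l ?qC// ltW.
have -> : d * ((c + 1) * nrm x) + b * (d * nrm x) = d * (c + 1 + b) * nrm x by ring.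
rewrite ler_wpM2r//; apply: le_trans ds; rewrite ler_wpM2l ?(ltW d0)// /s; lra.
Qed.

Lemma is_cfc_selfadj f A B : selfadj A -> is_cfc f A B -> selfadj B.
Proof.
move=> a hB x y; apply/eqP; rewrite -subr_eq0 -normr_le0; apply/ler_addgt0Pl => e e0.
rewrite addr0; pose n := nrm x * nrm y; have n0 : 0 <= n by rewrite mulr_ge0 ?nrm_ge0.
pose d := e / (2 * (n + 1)).
have d0 : 0 < d by rewrite divr_gt0//; lra.
have [p [_ /opnorm_leP pB]] := hB _ d0.
have sp := poly_op_selfadj p a.
have -> : rdot (B x) y - rdot x (B y) =
    rdot x ((poly_op p A - B) y) - rdot ((poly_op p A - B) x) y.
  by rewrite !opE !rdotE sp; ring.
apply: le_trans (ler_normB _ _) _.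
apply: (@le_trans _ _ (d * n + d * n)).
  apply: lerD; apply: le_trans (rdot_le_nrm _ _) _.
    by rewrite mulrCA ler_wpM2l ?nrm_ge0.
  by rewrite mulrA ler_wpM2r ?nrm_ge0.
have : 2 * d * (n + 1) = e by rewrite /d; field; lra.
lra.
Qed.

Lemma is_cfc_psd f A B : selfadj A -> is_cfc f A B ->
  (forall t, spectrum A t%:C -> 0 <= f t) -> forall x, 0 <= rdot (B x) x.
Proof.
move=> a hB f0 x; apply/ler_addgt0Pl => e e0.
have n0 := rdot_ge0 x; pose d := e / (2 * (rdot x x + 1)).
have d0 : 0 < d by rewrite divr_gt0//; lra.
have [p [pf /opnorm_leP pB]] := hB _ d0.
(* The approximation [p] may dip below zero by [d]; adding [d] restores positivity on the
   spectrum. *)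
have := @poly_op_psd _ _ (p + d%:P) A a _ x; rewrite poly_opD poly_opC !opE !rdotE.
have h : `|rdot ((poly_op p A - B) x) x| <= d * rdot x x.
  apply: le_trans (rdot_le_nrm _ _) _.
  by rewrite -sqr_nrm expr2 mulrA ler_wpM2r ?nrm_ge0.
have {}h : rdot (poly_op p A x) x <= rdot (B x) x + d * rdot x x.
  by have := le_trans (ler_norm _) h; rewrite !opE !rdotE; lra.
move=> h2; have {}h2 : 0 <= rdot (poly_op p A x) x + d * rdot x x.
  apply: h2 => t st; rewrite hornerD hornerC.
  by have := pf _ st; have := f0 _ st; rewrite ler_norml => ? /andP[]; lra.
have : 2 * d * (rdot x x + 1) = e by rewrite /d; field; lra.
lra.
Qed.

Lemma is_cfc_mono f g A B C : selfadj A -> is_cfc f A B -> is_cfc g A C ->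
  (forall t, spectrum A t%:C -> f t <= g t) -> B <=op C.
Proof.
move=> a hB hC fg; have B' := is_cfc_selfadj a hB; have C' := is_cfc_selfadj a hC.
apply: quad_leop => // x.
have := is_cfc_psd a (is_cfcD hC (is_cfcZ (- 1) hB)) _ x.
rewrite !opE !rdotE mulN1r subr_ge0; apply => t /fg; lra.
Qed.

Definition op_in a b A := [/\ selfadj A, forall x, a * rdot x x <= rdot (A x) x
  & forall x, rdot (A x) x <= b * rdot x x].

Lemma op_in_spectrum a b A t : op_in a b A -> spectrum A t%:C -> a <= t <= b.
Proof.
move=> [sa aA Ab] st.
by rewrite (selfadj_spectrum_ge sa aA st) (selfadj_spectrum_le sa Ab st).
Qed.

(** Polynomials within [1 / (n + 1)] of [f] on [[a, b]], which contains the spectrum, have values at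
    [A] that are Cauchy in norm with rate [2 / (n + 1)]. *)
Lemma is_cfc_exists f a b A : a < b -> {in `[a, b], continuous f} -> op_in a b A ->
  exists B, is_cfc f A B.
Proof.
move=> ab fc hA; have [sa _ _] := hA.
have /choice[p hp] n : exists p : {poly R}, forall t, a <= t <= b ->
    `|p.[t] - f t| <= n.+1%:R^-1.
  by apply: weierstrass => //; rewrite invr_gt0.
have dE n k t : (n <= k)%N -> spectrum A t%:C -> `|(p k - p n).[t]| <= 2 * n.+1%:R^-1.
  move=> nk /(op_in_spectrum hA) tab; rewrite hornerD hornerN -(subrKA (f t)).
  rewrite mulr_natl mulr2n; apply: le_trans (ler_normD _ _) _.
  rewrite lerD//; last by rewrite distrC hp.
  by apply: le_trans (hp _ _ tab) _; rewrite lef_pV2 ?posrE ?ltr0n// ler_nat.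
have small e : 0 < e -> exists N, forall n, (N <= n)%N -> 2 * n.+1%:R^-1 <= e.
  move=> e0; exists (Num.truncn (2 / e)) => n Nn.
  rewrite ler_pdivrMr// mulrC -ler_pdivrMr//; apply: ltW;
    apply: lt_le_trans (truncnS_gt _) _.
  by rewrite ler_nat.
have [||B hB] := @bop_complete _ _ (fun n => poly_op (p n) A) (fun n => 2 * n.+1%:R^-1).
- move=> n k x nk; rewrite -oppopE -addopE -poly_opB.
  by apply: poly_op_norm_le => // t; exact: dE.
- exact: small.
exists B => e /small[N /(_ N (leqnn _)) hN]; exists (p N); split.
  move=> t /(op_in_spectrum hA)/(hp N) /le_trans; apply; apply: le_trans hN.
  by rewrite ler_peMl ?invr_ge0// ler1n.
apply/opnorm_leP => x; rewrite addopE oppopE nrm_sub; apply: le_trans (hB N x) _.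
by rewrite ler_wpM2r ?nrm_ge0.
Qed.

Lemma cfcP f a b A : a < b -> {in `[a, b], continuous f} -> op_in a b A ->
  is_cfc f A (cfc f A).
Proof. by move=> ab fc hA; apply: xgetPex; exact: is_cfc_exists hA. Qed.

Lemma cfcE f A B : selfadj A -> is_cfc f A B -> cfc f A = B.
Proof.
move=> sa h; apply: (cfc_unique sa _ h).
by apply: (@xgetPex _ 0 [set C | is_cfc f A C]%classic); exists B.
Qed.

End FunctionalCalculus.

(** * Operator order and the Loewner-Heinz inequality *)

Section Order.
Context {R : realType} {H : hilbertType R}.
Implicit Types (x y z : H) (a b c d e t r s : R) (A B C S T : 'B(H)) (f g : R -> R).

Lemma leop_conj S A B : selfadj S -> A <=op B -> S * A * S <=op S * B * S.
Proof.
rewrite /loewner_le -mulrBl -mulrBr => s /positive_opP[a h].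
apply/positive_opP; split; first exact: selfadj_conj.
by move=> x; rewrite !mulopE s.
Qed.

Lemma leop_refl A : A <=op A.
Proof.
by rewrite /loewner_le subrr; apply/positive_opP; split; [exact: selfadj0 | move=> x;
  rewrite opE rdot0l].
Qed.

Lemma pos_inv_inverse A B : pos_inv A -> A * B = 1 -> pos_inv B.
Proof.
move=> hA AB; have a := pos_inv_selfadj hA.
have [_ BA] := inv_opP (proj2 hA).
have BE : inv_op A = B by rewrite -[LHS]mulr1 -AB mulrA BA mul1r.
rewrite BE in BA; split; last by exists A.
have /positive_opP[_ A0] := proj1 hA.
have AxB x : A (B x) = x by rewrite -mulopE AB.
apply/positive_opP; split=> [x y|x].
  by rewrite -{2}(AxB x) a AxB.
by rewrite -{2}(AxB x) rdotC.
Qed.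

(** Expanding the form of [A] at [B' x - A' x] gives [<A' x, x> >= 2 <B' x, x> - <A B' x, B' x>],
    and [A <= B] bounds the last term by [<B' x, x>]. *)
Lemma leop_inv A B A' B' : pos_inv A -> pos_inv B -> A * A' = 1 -> B * B' = 1 ->
  A <=op B -> B' <=op A'.
Proof.
move=> hA hB AA BB AB.
apply: quad_leop; [exact: pos_inv_selfadj (pos_inv_inverse hB BB)|
  exact: pos_inv_selfadj (pos_inv_inverse hA AA)|move=> x].
have /positive_opP[a A0] := proj1 hA.
have := A0 (B' x - A' x); have := leop_quad (B' x) AB.
have E1 : A (A' x) = x by rewrite -mulopE AA.
have E2 : B (B' x) = x by rewrite -mulopE BB.
rewrite bopD bopN E1 E2 !rdotE (a (B' x) (A' x)) E1 !(rdotC x); lra.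
Qed.

(** Otherwise [S * S] is bounded below by [e], hence invertible, and so is its factor [S]. *)
Lemma approximate_eigenvector S e : selfadj S -> ~ invertible_op S -> 0 < e ->
  exists x, rdot (S x) (S x) < e * rdot x x.
Proof.
move=> s hS e0; apply: contrapT => hx; apply: hS.
apply: (@comm_invertible _ _ S S) => //.
apply: (@lower_bounded_invertible _ _ _ e) => //; first exact: selfadjM.
by move=> x; rewrite mulopE s leNgt; apply/negP => h; apply: hx; exists x.
Qed.

(* A negative spectral value [l] of [B - A] would have an approximate
   eigenvector [x], and then [|A x|^2] is close to
   [|B x|^2 - 2 l <B x, x> + l^2 |x|^2], hence larger than [|B x|^2]. *)
Lemma leop_sqr A B : selfadj A -> positive_op B -> A * A <=op B * B -> A <=op B.
Proof.
move=> a /positive_opP[b B0] AB; apply: quad_leop => // x0; rewrite leNgt.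
apply/negP => hx; have sD : selfadj (B - A) by exact: selfadjB.
have [|l l0 sl] := numerical_range_inf (x := x0) sD.
  by rewrite !opE !rdotE subr_lt0.
have [k k0 Bk] := bop_bounded B.
(* Makes the cross term [2 <w, v>] at most half of [l^2 |x|^2], given [|w| <= (k - l) |x|] and
   [|v| < d |x|]. *)
pose d := l ^+ 2 / (4 * (k - l)).
have l2 : 0 < l ^+ 2 by rewrite exprn_even_gt0//= lt_eqF.
have d0 : 0 < d by apply: divr_gt0 => //; lra.
have dE : 4 * (k - l) * d = l ^+ 2 by rewrite /d; field; lra.
clearbody d; have d0' := ltW d0.
have sS : selfadj (B - A - l%:C *: (1 : 'B(H))) by apply: selfadjB => //; exact: selfadjZ.
have [|x] := approximate_eigenvector (e := d ^+ 2) sS sl; first by rewrite exprn_gt0.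
set v := (_ : 'B(H)) x => hv.
have AxE : A x = (B x - l%:C *: x) - v.
  by rewrite /v !opE (addrAC (B x) (- A x)) subKr.
have nx : 0 < nrm x.
  rewrite lt_neqAle nrm_ge0 andbT; apply/negP => /eqP/esym/nrm0_eq0 xz.
  by move: hv; rewrite xz rdot0r mulr0 ltNge rdot_ge0.
have nv : nrm v < d * nrm x.
  rewrite -(@ltr_pXn2r _ 2) ?nnegrE ?nrm_ge0 //; last by rewrite mulr_ge0 ?nrm_ge0.
  by rewrite exprMn !sqr_nrm.
set w := B x - l%:C *: x in AxE.
have nw : nrm w <= (k - l) * nrm x.
  apply: le_trans (ler_nrmD _ _) _; rewrite nrmN nrmZ ltr0_norm// mulrBl mulNr.
  by rewrite lerD.
have hwv : rdot w v <= (k - l) * nrm x * (d * nrm x).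
  apply: le_trans (ler_norm _) _; apply: le_trans (rdot_le_nrm _ _) _.
  by apply: ler_pM nw (ltW nv); exact: nrm_ge0.
have wE : rdot w w = rdot (B x) (B x) - 2 * l * rdot (B x) x + l ^+ 2 * rdot x x.
  by rewrite /w !rdotE (rdotC x (B x)); ring.
clearbody w v.
have := leop_quad x AB; rewrite !mulopE a b AxE !rdotBl !rdotBr (rdotC v w).
have := B0 x; have := rdot_ge0 v;
move: hwv; rewrite wE => hwv v0 Bx0 h.
have : (k - l) * nrm x * (d * nrm x) = l ^+ 2 / 4 * nrm x ^+ 2.
  by rewrite -dE; field.
rewrite sqr_nrm => e1; rewrite e1 in hwv.
have : 0 < l ^+ 2 * rdot x x by rewrite -sqr_nrm; apply: mulr_gt0 => //; exact: exprn_gt0.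
have : l * rdot (B x) x <= 0 by rewrite nmulr_rle0.
lra.
Qed.

Lemma pos_inv_op_in A : pos_inv A -> exists a b, [/\ 0 < a, a < b & op_in a b A].
Proof.
move=> hA; have [c [d [c0 d0 cA Ad]]] := pos_inv_bounds hA.
exists c, (c + d); split => //; first by rewrite ltrDl.
split=> //; first exact: pos_inv_selfadj.
by move=> x; apply: le_trans (Ad x) _; rewrite ler_wpM2r ?rdot_ge0// lerDr ltW.
Qed.

Lemma continuous_powR r t : 0 < t -> {for t, continuous (fun u => u `^ r)}.
Proof.
move=> t0; apply: differentiable_continuous; apply/derivable1_diffP.
by have := is_derive1_powR r t0 => -[].
Qed.

Lemma op_in_pos_inv a b A : 0 < a -> op_in a b A -> pos_inv A.
Proof. by move=> a0 [sa aA _]; exact: bounds_pos_inv a0 aA. Qed.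

Lemma cfc_pos_invP f A : pos_inv A -> (forall t, 0 < t -> {for t, continuous f}) ->
  is_cfc f A (cfc f A).
Proof.
move=> hA fc; have [a [b [a0 ab hab]]] := pos_inv_op_in hA.
apply: cfcP ab _ hab => t; rewrite in_itv /= => /andP[at_ _]; apply: fc.
exact: lt_le_trans at_.
Qed.

Lemma pos_inv_spectrum A t : pos_inv A -> spectrum A t%:C -> 0 < t.
Proof.
move=> hA st; have [a [b [a0 _ hab]]] := pos_inv_op_in hA.
by have /andP[at_ _] := op_in_spectrum hab st; exact: lt_le_trans at_.
Qed.

Lemma pow_opP A r : pos_inv A -> is_cfc (fun t => t `^ r) A (pow_op A r).
Proof. by move=> hA; apply: cfc_pos_invP => // t; exact: continuous_powR. Qed.

Lemma pow_op_uniq f A B r : pos_inv A -> is_cfc f A B ->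
  (forall t, 0 < t -> f t = t `^ r) -> B = pow_op A r.
Proof.
move=> hA hB fr; have a := pos_inv_selfadj hA.
apply: (cfc_unique a _ (pow_opP r hA)).
by apply: is_cfc_ext hB => t /(pos_inv_spectrum hA)/fr.
Qed.

Lemma pow_opD A r s : pos_inv A -> pow_op A r * pow_op A s = pow_op A (r + s).
Proof.
move=> hA; have a := pos_inv_selfadj hA.
apply: (pow_op_uniq hA (is_cfcM a (pow_opP r hA) (pow_opP s hA))) => t t0.
by rewrite powRD// (gt_eqF t0) implybT.
Qed.

Lemma pow_op0 A : pos_inv A -> pow_op A 0 = 1.
Proof.
move=> hA; symmetry; apply: (@pow_op_uniq (horner 1%:P) _ _ _ hA).
  by have := is_cfc_poly 1%:P A; rewrite poly_opC scale1r.
by move=> t _; rewrite hornerC powRr0.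
Qed.

Lemma pow_op1 A : pos_inv A -> pow_op A 1 = A.
Proof.
move=> hA; symmetry; apply: (@pow_op_uniq (horner 'X) _ _ _ hA).
  by have := is_cfc_poly 'X A; rewrite poly_opX.
by move=> t t0; rewrite hornerX powRr1// ltW.
Qed.

Lemma pow_opV A r : pos_inv A -> pow_op A r * pow_op A (- r) = 1.
Proof. by move=> hA; rewrite pow_opD// subrr pow_op0. Qed.

Lemma pow_opN1 A : pos_inv A -> pow_op A (- 1) = inv_op A.
Proof.
move=> hA; symmetry; apply: inv_op_eq.
  by rewrite -{1}(pow_op1 hA) pow_opV.
by rewrite -{2}(pow_op1 hA) pow_opD// addNr pow_op0.
Qed.

Lemma pow_op_selfadj A r : pos_inv A -> selfadj (pow_op A r).
Proof. by move=> hA; exact: is_cfc_selfadj (pos_inv_selfadj hA) (pow_opP r hA). Qed.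

Lemma pow_op_pos_inv A r : pos_inv A -> pos_inv (pow_op A r).
Proof.
move=> hA; split; last first.
  exists (pow_op A (- r)); split; first exact: pow_opV.
  by rewrite pow_opD// addNr pow_op0.
apply/positive_opP; split; first exact: pow_op_selfadj.
apply: (is_cfc_psd (pos_inv_selfadj hA) (pow_opP r hA)) => t _.
exact: powR_ge0.
Qed.

(** Here [Q V Q] is the geometric mean of [Q Q] and [X], the largest solution of the Riccati
    inequality [G (P P) G <= X]. Conjugating by [P] turns that inequality into [(P G P)^2 <= V^2],
    where square roots can be taken. *)
Lemma leop_congr_sqrt (G P Q V X : 'B(H)) : selfadj G -> selfadj P -> selfadj Q ->
  Q * P = 1 -> P * Q = 1 -> positive_op V -> V * V = P * X * P ->
  G * (P * P) * G <=op X -> G <=op Q * V * Q.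
Proof.
move=> g p q QP PQ v VV h.
have h' : P * G * P <=op V.
  apply: leop_sqr => //; first exact: selfadj_conj.
  have -> : P * G * P * (P * G * P) = P * (G * (P * P) * G) * P by rewrite !mulrA.
  by rewrite VV; exact: leop_conj.
have -> : G = Q * (P * G * P) * Q by rewrite -!mulrA PQ mulr1 mulrA QP mul1r.
exact: leop_conj.
Qed.

(** [B^((r + s) / 2)] is the geometric mean of [B^r] and [B^s]. For [G = A^((r + s) / 2)] the
    Riccati inequality holds, as [G B^(- r) G <= G A^(- r) G = A^s <= B^s]. *)
Lemma leop_pow_mid A B r s : pos_inv A -> pos_inv B ->
  pow_op A r <=op pow_op B r -> pow_op A s <=op pow_op B s ->
  pow_op A ((r + s) / 2) <=op pow_op B ((r + s) / 2).
Proof.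
move=> hA hB h1 h2.
have e1 : (r + s) / 2 = r / 2 + (s - r) / 2 + r / 2 by field.
have e2 : (s - r) / 2 + (s - r) / 2 = - (r / 2) + s + - (r / 2) by field.
have e3 : - (r / 2) + - (r / 2) = - r by field.
have e4 : (r + s) / 2 + - r + (r + s) / 2 = s by field.
rewrite {2}e1 -(pow_opD _ _ hB) -(pow_opD _ _ hB).
apply: (@leop_congr_sqrt _ (pow_op B (- (r / 2))) _ _ (pow_op B s)).
- exact: pow_op_selfadj.
- exact: pow_op_selfadj.
- exact: pow_op_selfadj.
- exact: pow_opV.
- by rewrite (pow_opD _ _ hB) addNr pow_op0.
- exact: (proj1 (pow_op_pos_inv _ hB)).
- by rewrite !(pow_opD _ _ hB) e2.
- apply: leop_trans h2;
  rewrite (pow_opD _ _ hB) e3 -{3}e4 -(pow_opD _ _ hA) -(pow_opD _ _ hA).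
  apply: leop_conj; first exact: pow_op_selfadj.
  by apply: leop_inv h1;
    [exact: pow_op_pos_inv | exact: pow_op_pos_inv | exact: pow_opV | exact: pow_opV].
Qed.

(** Continuity in the exponent in multiplicative form: on the spectrum [t^(r - s) <= exp (e k)]. *)
Lemma pow_op_perturb A k e r s : pos_inv A -> 0 <= k -> `|r - s| <= e ->
  (forall t, spectrum A t%:C -> `|ln t| <= k) ->
  forall x, rdot (pow_op A r x) x <= expR (e * k) * rdot (pow_op A s x) x.
Proof.
move=> hA k0 rs hk x; have a := pos_inv_selfadj hA.
have := leop_quad x (is_cfc_mono a (pow_opP r hA) (is_cfcZ (expR (e * k)) (pow_opP s
  hA)) _).
rewrite scaleopE rdotZl; apply=> t st; have t0 := pos_inv_spectrum hA st.
rewrite -{1}[r](subrK s) powRD; last by rewrite (gt_eqF t0) implybT.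
rewrite ler_wpM2r ?powR_ge0// /powR gt_eqF// ler_expR.
apply: le_trans (ler_norm _) _; rewrite normrM; apply: ler_pM => //; exact: hk.
Qed.

Lemma le_expR_dyadic (p q k : R) : 0 <= q -> 0 <= k ->
  (forall n, p <= expR (2^-1 ^+ n * k) * q) -> p <= q.
Proof.
move=> q0 k0 key.
apply/ler_addgt0Pr => e e0.
have [y [y0 hy]] : exists y : R, 0 < y /\ expR y * q <= q + e.
  exists (ln (1 + e / (q + 1))).
  have eq0 : 0 < e / (q + 1) by rewrite divr_gt0//; lra.
  split; first by rewrite ln_gt0//; lra.
  rewrite lnK ?posrE; last lra.
  rewrite mulrDl mul1r lerD2l mulrAC ler_pdivrMr; last lra.
  by rewrite ler_wpM2l ?(ltW e0)//; lra.
have i0 : 0 <= 2^-1 :> R by [].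
have i1 : 2^-1 < 1 :> R by lra.
have [N hN] := expr_small i0 i1 k0 y0.
apply: le_trans (key N) _; apply: le_trans hy.
by rewrite ler_wpM2r// ler_expR hN.
Qed.

(* The exponents [r] with [A^r <= B^r] contain 0 and 1 and are closed under
   midpoints, so they approximate every point of [[0, 1]]. *)
Theorem loewner_heinz A B r : pos_inv A -> pos_inv B -> A <=op B ->
  0 <= r -> r <= 1 -> pow_op A r <=op pow_op B r.
Proof.
move=> hA hB AB r0 r1.
have dyadic n : exists l, exists u, [/\ l <= r, r <= u, u - l = 2^-1 ^+ n,
    pow_op A l <=op pow_op B l & pow_op A u <=op pow_op B u].
  elim: n => [|n [l [u [lr ru ul hl hu]]]].
    exists 0, 1; rewrite subr0 expr0; split=> //.
      by rewrite !pow_op0//; exact: leop_refl.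
    by rewrite !pow_op1.
  have hm := leop_pow_mid hA hB hl hu.
  have [mr|mr] := leP ((l + u) / 2) r.
    by exists ((l + u) / 2), u; split=> //; rewrite exprS -ul; field.
  by exists l, ((l + u) / 2); split=> //; [exact: ltW | rewrite exprS -ul; field].
have logb C : pos_inv C -> exists2 k : R, 0 <= k & forall t, spectrum C t%:C -> `|ln t|
  <= k.
  move=> hC; have [a [b [a0 ab hab]]] := pos_inv_op_in hC.
  exists (`|ln a| + `|ln b|) => [|t st]; first by rewrite addr_ge0.
  have /andP[at_ tb] := op_in_spectrum hab st; have t0 : 0 < t by exact: lt_le_trans at_.
  have l1 : ln a <= ln t by rewrite ler_ln.
  have l2 : ln t <= ln b by rewrite ler_ln// posrE; apply: lt_le_trans tb.
  have := ler_norm (ln b); have := ler_norm (- ln a); rewrite normrN => h1 h2.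
  have := normr_ge0 (ln a); have := normr_ge0 (ln b) => h3 h4.
  by rewrite ler_norml; apply/andP; split; lra.
have [k k0 hk] := logb A hA; have [k' k0' hk'] := logb B hB.
apply: quad_leop => [||x]; [exact: pow_op_selfadj | exact: pow_op_selfadj |].
have q0 : 0 <= rdot (pow_op B r x) x.
  by have /positive_opP[_ /(_ x)] := proj1 (pow_op_pos_inv r hB).
have key n : rdot (pow_op A r x) x <= expR (2^-1 ^+ n * (k + k')) * rdot (pow_op B r x) x.
  have [l [u [lr ru ul hl _]]] := dyadic n.
  have rl : `|r - l| <= 2^-1 ^+ n by rewrite -ul ger0_norm ?subr_ge0// lerD2r.
  apply: le_trans (pow_op_perturb hA k0 rl hk x) _.
  rewrite mulrDr expRD -mulrA ler_wpM2l ?expR_ge0//.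
  apply: le_trans (leop_quad x hl) _.
  by apply: (pow_op_perturb hB k0' _ hk'); rewrite distrC.
exact: le_expR_dyadic q0 (addr_ge0 k0 k0') key.
Qed.

End Order.

(** * Functions monotone on 2x2 matrices *)

Section TwoMonotone.
Context {R : realType}.
Implicit Types (a b c s p l t u x y : R) (f : R -> R).

(* [rotated_le a b c s p l] says that the symmetric 2x2 matrix with eigenvalues
   [a], [b] and orthonormal eigenvectors [(c, s)], [(- s, c)] is below
   [diag (p, l)]. *)
Definition rotated_le a b c s p l := forall x y,
  a * (c * x + s * y) ^+ 2 + b * (- s * x + c * y) ^+ 2 <= p * x ^+ 2 + l * y ^+ 2.

Definition two_monotone f := forall a b c s p l,
  0 < a -> 0 < b -> 0 < p -> 0 < l -> c ^+ 2 + s ^+ 2 = 1 ->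
  rotated_le a b c s p l -> rotated_le (f a) (f b) c s (f p) (f l).

(** Inversion reverses the matrix order. Seen in the eigenbasis of the left matrix, the diagonal
    matrix is the one rotated, by the opposite angle, so the result has the same shape again. *)
Lemma rotated_le_inv a b c s p l : 0 < a -> 0 < b -> 0 < p -> 0 < l ->
  c ^+ 2 + s ^+ 2 = 1 -> rotated_le a b c s p l ->
  rotated_le p^-1 l^-1 c (- s) a^-1 b^-1.
Proof.
move=> a0 b0 p0 l0 cs h X Y.
set X' := c * X + - s * Y; set Y' := - - s * X + c * Y.
have := h (X' / p) (Y' / l); set U := c * _ + _; set V := - s * _ + _ => h1.
have e : U * X + V * Y = p^-1 * X' ^+ 2 + l^-1 * Y' ^+ 2.
  rewrite /U /V /X' /Y'; field.
  by rewrite !gt_eqF.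
have e2 : p * (X' / p) ^+ 2 + l * (Y' / l) ^+ 2 = p^-1 * X' ^+ 2 + l^-1 * Y' ^+ 2.
  by field; rewrite !gt_eqF.
have k1 : 2 * (U * X) <= a * U ^+ 2 + a^-1 * X ^+ 2.
  rewrite -subr_ge0 (_ : _ - _ = a^-1 * (a * U - X) ^+ 2); last by field; rewrite gt_eqF.
  by rewrite mulr_ge0 ?sqr_ge0// invr_ge0 ltW.
have k2 : 2 * (V * Y) <= b * V ^+ 2 + b^-1 * Y ^+ 2.
  rewrite -subr_ge0 (_ : _ - _ = b^-1 * (b * V - Y) ^+ 2); last by field; rewrite gt_eqF.
  by rewrite mulr_ge0 ?sqr_ge0// invr_ge0 ltW.
by rewrite e2 in h1; lra.
Qed.

(** A Schur complement: [q] is the upper corner of the rotated matrix, [m] its off-diagonal entry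
    and [n] its lower corner, so [l >= n + m^2 / (p - q)] is enough. *)
Lemma rotated_le_large a b c s p : 0 < a -> 0 < b -> c ^+ 2 * a + s ^+ 2 * b < p ->
  exists2 l0 : R, 0 < l0 & forall l, l0 <= l -> rotated_le a b c s p l.
Proof.
move=> a0 b0; set q := _ + _ => qp.
set m := c * s * (a - b); set n := s ^+ 2 * a + c ^+ 2 * b.
have pq : 0 < p - q by rewrite subr_gt0.
have n0 : 0 <= n by rewrite addr_ge0// mulr_ge0 ?sqr_ge0// ltW.
have mq : 0 <= m ^+ 2 / (p - q) by rewrite mulr_ge0 ?sqr_ge0// invr_ge0 ltW.
exists (n + m ^+ 2 / (p - q) + 1) => [|l hl x y]; first by lra.
have -> : a * (c * x + s * y) ^+ 2 + b * (- s * x + c * y) ^+ 2 =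
    q * x ^+ 2 + 2 * m * (x * y) + n * y ^+ 2 by rewrite /q /m /n; ring.
have h1 : 2 * m * (x * y) <= (p - q) * x ^+ 2 + m ^+ 2 / (p - q) * y ^+ 2.
  rewrite -subr_ge0 (_ : _ - _ = (p - q)^-1 * ((p - q) * x - m * y) ^+ 2).
    by rewrite mulr_ge0 ?sqr_ge0// invr_ge0 ltW.
  by field; rewrite gt_eqF.
have h2 : (n + m ^+ 2 / (p - q)) * y ^+ 2 <= l * y ^+ 2.
  by rewrite ler_wpM2r ?sqr_ge0//; lra.
lra.
Qed.

Context {f : R -> R} (fm : two_monotone f)
  (fc : forall t, 0 < t -> {for t, continuous f}).

Lemma two_monotone_le t u : 0 < t -> t <= u -> f t <= f u.
Proof.
move=> t0 tu; have u0 : 0 < u by exact: lt_le_trans tu.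
have := @fm t 1 1 0 u 1 t0 ltr01 u0 ltr01 _ _ 1 0.
rewrite !expr1n !expr0n /= !(mulr0, mulr1, mul1r, addr0, oppr0, mul0r) !expr1n !expr0n.
rewrite !(mulr0, mulr1, addr0) => -> // x y.
by rewrite !(mul0r, mul1r, addr0, oppr0, add0r) lerD2r ler_wpM2r ?sqr_ge0.
Qed.

(** With [c^2 = 1 - k] and [s^2 = k], the upper corner of the rotated matrix is the convex
    combination [q]. For [p > q] it lies below some [diag (p, l)]; applying [f] and testing at
    [(1, 0)] bounds the combination of values by [f p], and [p] tends to [q]. *)
Lemma two_monotone_concave a b k : 0 < a -> 0 < b -> 0 <= k <= 1 ->
  (1 - k) * f a + k * f b <= f ((1 - k) * a + k * b).
Proof.
move=> a0 b0 /andP[k0 k1]; set q := (1 - k) * a + k * b.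
have q0 : 0 < q by rewrite /q; have [] := ltP k 1; nra.
have k1' : 0 <= 1 - k by rewrite subr_ge0.
have key p : q < p -> (1 - k) * f a + k * f b <= f p.
  move=> qp; have := @rotated_le_large a b (Num.sqrt (1 - k)) (Num.sqrt k) p a0 b0.
  rewrite !sqr_sqrtr// => /(_ qp)[l l0 /(_ l (lexx _)) h].
  have := @fm a b (Num.sqrt (1 - k)) (Num.sqrt k) p l a0 b0 (lt_trans q0 qp) l0 _ h 1 0.
  rewrite !sqr_sqrtr// !mulr0 !mulr1 !addr0 sqrrN !sqr_sqrtr// subrK => /(_ erefl).
  by rewrite expr1n expr0n mulr0 addr0 mulr1 !(mulrC (f _)).
apply/ler_addgt0Pr => e e0.
have /cvgrPdist_le/(_ e e0)/nbhs_ballP[d /= d0 hd] := fc q0.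
have d2 : 0 < d / 2 by rewrite divr_gt0.
have := hd (q + d / 2) _; rewrite /ball /= opprD addNKr normrN gtr0_norm//.
rewrite ltr_pdivrMr// ltr_pMr ?ltr1n// => /(_ isT); rewrite ler_norml => /andP[h _].
have := key (q + d / 2); rewrite ltrDl d2 => /(_ isT); lra.
Qed.

Hypothesis (f1 : f 1 = 1) (fn : exists2 t : R, 0 < t & f t != 1).

(* Testing the matrix inequality on the vector [(- s, c)], which is orthogonal to
   the first eigenvector, bounds [f 1] by a convex combination of [f t] and
   [f l]; if [f <= 1], this forces [f t >= 1] for all [t]. *)
Lemma two_monotone_gt1 : exists2 t, 1 < t & 1 < f t.
Proof.
apply: contrapT => h; have le1 t : 0 < t -> f t <= 1.
  move=> t0; have [t1|t1] := leP t 1; first by rewrite -f1; exact: two_monotone_le.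
  by rewrite leNgt; apply/negP => ft; apply: h; exists t.
have [t t0 /eqP] := fn; apply; apply/le_anti; rewrite le1//=.
have [t1|t1] := leP 1 t; first by rewrite -f1 two_monotone_le.
have t2 : 0 < t / 2 by rewrite divr_gt0.
have t3 : 0 <= 1 - t / 2 by lra.
(* Eigenvalues [t / 2] and [1], the latter with weight [t / 2], give the corner [t - t^2 / 4],
   strictly below [t] as domination requires. *)
have [|l l0 /(_ l (lexx _)) hl] :=
  @rotated_le_large (t / 2) 1 (Num.sqrt (1 - t / 2)) (Num.sqrt (t / 2)) t t2 ltr01.
  by rewrite !sqr_sqrtr// ?ltW//; nra.
have := @fm _ _ _ _ _ _ t2 ltr01 t0 l0 _ hl (- Num.sqrt (t / 2)) (Num.sqrt (1 - t / 2)).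
rewrite f1 !sqrrN !mulrNN -!expr2 !sqr_sqrtr// ?(ltW t2)// subrK => /(_ erefl).
set c := Num.sqrt (1 - _); set u := Num.sqrt (t / 2).
have -> : c * - u + u * c = 0 by ring.
have -> : t / 2 + (1 - t / 2) = 1 by ring.
rewrite expr1n expr0n mulr0 mulr1 add0r => h1.
have := le1 _ l0; nra.
Qed.

(** By concavity the chord slopes from [1] to the right are bounded by those to the left. Their
    supremum supports [f] at [1], and it is positive because one of them is. *)
Lemma two_monotone_tangent : exists2 s : R, 0 < s & forall t, 0 < t -> f t <= 1 + s *
  (t - 1).
Proof.
have [t1 t11 ft1] := two_monotone_gt1.
have slope u t : 0 < u -> u < 1 -> 1 < t -> (f t - 1) / (t - 1) <= (1 - f u) / (1 - u).
  move=> u0 u1 t_gt1; have tu : 0 < t - u by lra.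
  have := @two_monotone_concave u t ((1 - u) / (t - u)) u0 (lt_trans ltr01 t_gt1).
  rewrite divr_ge0 ?(ltW tu) ?subr_ge0 ?(ltW u1)//= ler_pdivrMr// mul1r lerD2r (ltW
    t_gt1).
  move=> /(_ isT); have -> : (1 - (1 - u) / (t - u)) * u + (1 - u) / (t - u) * t = 1.
    by field; rewrite gt_eqF.
  have -> : (1 - (1 - u) / (t - u)) * f u + (1 - u) / (t - u) * f t =
    ((t - 1) * f u + (1 - u) * f t) / (t - u) by field; rewrite gt_eqF.
  rewrite f1 ler_pdivrMr// mul1r => h.
  rewrite ler_pdivrMr; last lra.
  rewrite mulrAC ler_pdivlMr; lra.
pose S := [set z | exists2 t, 1 < t & z = (f t - 1) / (t - 1)]%classic.
have Sub u : 0 < u -> u < 1 -> ubound S ((1 - f u) / (1 - u)).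
  by move=> u0 u1 _ [t t_gt1 ->]; exact: slope.
have S1 : S ((f t1 - 1) / (t1 - 1)) by exists t1.
have hS : has_sup S.
  split; first by exists ((f t1 - 1) / (t1 - 1)).
  by exists ((1 - f 2^-1) / (1 - 2^-1)); apply: Sub => //; lra.
exists (sup S) => [|t t0].
  apply: (@lt_le_trans _ _ ((f t1 - 1) / (t1 - 1))); first by rewrite divr_gt0// subr_gt0.
  by apply: ub_le_sup S1; case: hS.
have [tl|tg|->] := ltgtP t 1; last by rewrite f1 subrr mulr0 addr0.
  have : sup S <= (1 - f t) / (1 - t) by apply: ge_sup; [case: hS | exact: Sub].
  rewrite ler_pdivlMr; lra.
have : (f t - 1) / (t - 1) <= sup S by apply: ub_le_sup; [case: hS | exists t].
rewrite ler_pdivrMr; lra.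
Qed.

Lemma two_monotone_gt0 : (forall t, 0 < t -> 0 <= f t) -> forall t, 0 < t -> 0 < f t.
Proof.
move=> f0 t t0; have [t1|t1] := leP 1 t.
  by apply: lt_le_trans ltr01 _; rewrite -[leLHS]f1 two_monotone_le.
have t2 : 0 < t / 2 by rewrite divr_gt0.
(* The weight that puts [t] between [t / 2] and [1]; concavity then gives [f t >= k]. *)
pose k := (t / 2) / (1 - t / 2); have k0 : 0 < k by rewrite divr_gt0//; lra.
have k1 : k <= 1 by rewrite ler_pdivrMr; lra.
have := @two_monotone_concave (t / 2) 1 k t2 ltr01; rewrite (ltW k0) k1 => /(_ isT).
have -> : (1 - k) * (t / 2) + k * 1 = t by rewrite /k; field; lra.
rewrite f1 => h; apply: lt_le_trans h; have := f0 _ t2; nra.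
Qed.

End TwoMonotone.

Section Adjoint.
Context {R : realType} (f : R -> R) (fm : two_monotone f)
  (fc : forall t, 0 < t -> {for t, continuous f})
  (f0 : forall t, 0 < t -> 0 <= f t) (f1 : f 1 = 1) (fn : exists2 t : R, 0 < t & f t !=
    1).

(** The representing function of the adjoint mean. Order is reversed once before and once after
    applying [f], and the two changes of angle cancel. *)
Lemma two_monotone_adjoint : two_monotone (fun t => (f t^-1)^-1).
Proof.
have fp := two_monotone_gt0 fm fc f1 f0.
move=> a b c s p l a0 b0 p0 l0 cs h.
have cs' : c ^+ 2 + (- s) ^+ 2 = 1 by rewrite sqrrN.
have := fm _ _ _ _ cs' (rotated_le_inv a0 b0 p0 l0 cs h); rewrite !invr_gt0.
move=> /(_ p0 l0 a0 b0) h1.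
have := rotated_le_inv _ _ _ _ cs' h1; rewrite opprK; apply; apply: fp;
  by rewrite invr_gt0.
Qed.

Lemma two_monotone_harmonic_tangent : exists2 s : R, 0 < s &
  forall t, 0 < t -> (f t)^-1 <= 1 + s * (t^-1 - 1).
Proof.
have fp := two_monotone_gt0 fm fc f1 f0.
have [|||s s0 hs] := two_monotone_tangent two_monotone_adjoint.
- move=> t t0; apply: continuousV; first by rewrite gt_eqF// fp// invr_gt0.
  apply: continuous_comp; last by apply: fc; rewrite invr_gt0.
  by apply: continuousV => //; rewrite gt_eqF.
- by rewrite invr1 f1 invr1.
- have [t t0 ft] := fn; exists t^-1; rewrite ?invr_gt0// invrK.
  by apply: contra ft => /eqP h; rewrite -[f t]invrK h invr1.
by exists s => // t t0; rewrite -{1}[t]invrK hs// invr_gt0.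
Qed.

End Adjoint.

(** * Scalar Mond-Pecaric inequalities *)

Section MondPecaric.
Context {R : realType}.
Implicit Types (m M r t u x alpha : R).

(** By scaling, the case [t = 1] suffices, where [u^r = exp (r ln u) >= 1 + r ln u >= 1 + r (u - 1)]
    since [r < 0]. *)
Lemma powR_tangent r t x : r < 0 -> 0 < t -> 0 < x ->
  t `^ r + r * t `^ (r - 1) * (x - t) <= x `^ r.
Proof.
move=> r0 t0 x0; have bern u : 0 < u -> 1 + r * (u - 1) <= u `^ r.
  move=> u0; rewrite /powR gt_eqF//; apply: le_trans (expR_ge1Dx _).
  rewrite lerD2l; apply: ler_wnM2l; first exact: ltW.
  have := @le_ln1Dx _ (u - 1); rewrite (_ : 1 + (u - 1) = u); last by ring.
  by apply; lra.
have t1 : t `^ (r - 1) = t `^ r / t.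
  by rewrite powRB ?powRr1 ?(ltW t0)// (gt_eqF t0) implybT.
have -> : x = t * (x / t) by field; rewrite gt_eqF.
rewrite powRM ?(ltW t0) ?divr_ge0 ?(ltW x0) ?(ltW t0)// t1.
have -> : t `^ r + r * (t `^ r / t) * (t * (x / t) - t) = t `^ r * (1 + r * (x / t - 1)).
  by field; rewrite gt_eqF.
by rewrite ler_wpM2l ?powR_ge0// bern// divr_gt0.
Qed.

Definition chord m M r t := (M `^ r - m `^ r) / (M - m) * (t - m) + m `^ r.

(** Averaging the tangent at [t] over the two endpoints, with the barycentric weights of [t],
    removes its slope term. *)
Lemma powR_le_chord m M r t : r < 0 -> 0 < m -> m < M -> m <= t <= M ->
  t `^ r <= chord m M r t.
Proof.
move=> r0 m0 mM /andP[mt tM]; have t0 := lt_le_trans m0 mt.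
have h1 := powR_tangent r0 t0 m0; have h2 := powR_tangent r0 t0 (lt_trans m0 mM).
have Mm : 0 < M - m by rewrite subr_gt0.
have -> : chord m M r t = ((M - t) * m `^ r + (t - m) * M `^ r) / (M - m).
  by rewrite /chord; field; rewrite gt_eqF.
rewrite ler_pdivlMr//.
have : 0 <= t - m by lra.
have : 0 <= M - t by lra.
nra.
Qed.

(** The difference of the chord and [alpha * t ^ r] is concave, with critical point [u = t0]: there
    [u^(r - 1) = B], and [alpha * r * B] is the slope of the chord. The tangent of the power is
    taken at [u], or at the endpoint nearest to [u] when [u] lies outside, where [anti] settles the
    sign of the leftover slope. *)
Lemma chord_le_gamma m M r alpha t : r < 0 -> 0 < m -> m < M -> 0 < alpha ->
  m <= t <= M -> chord m M r t <= alpha * t `^ r + gamma_const m M r alpha.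
Proof.
move=> r0 m0 mM al0 /andP[mt tM]; have t0 := lt_le_trans m0 mt.
have M0 := lt_trans m0 mM; have Mm : 0 < M - m by rewrite subr_gt0.
have r1 : r - 1 < 0 by lra.
have anti u v : 0 < u -> u <= v -> v `^ (r - 1) <= u `^ (r - 1).
  move=> u0 uv; have v0 := lt_le_trans u0 uv.
  apply: le_trans (powR_tangent r1 v0 u0).
  rewrite lerDl mulr_le0 ?subr_le0//; rewrite nmulr_rle0// powR_ge0//.
have Mr : M `^ r < m `^ r.
  apply: lt_le_trans (powR_tangent r0 M0 m0).
  by rewrite ltrDl nmulr_lgt0 ?subr_lt0// nmulr_rlt0// powR_gt0.
set B := gamma_base m M r alpha; set u := gamma_t0 m M r alpha.
have slE : (M `^ r - m `^ r) / (M - m) = alpha * r * B.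
  by rewrite /B /gamma_base; field; rewrite (gt_eqF Mm) (lt_eqF r0) (gt_eqF al0).
have B0 : 0 < B.
  by rewrite /B /gamma_base nmulr_rgt0 ?subr_lt0// invr_lt0 nmulr_rlt0 ?subr_gt0//
    pmulr_rlt0.
have u0 : 0 < u by exact: powR_gt0.
have uB : u `^ (r - 1) = B.
  by rewrite /u /gamma_t0 -powRrM mulVf ?lt_eqF// powRr1// ltW.
have ur : B `^ (r / (r - 1)) = u `^ r by rewrite /u /gamma_t0 -powRrM mulrC.
have uBr : B * u = u `^ r.
  by rewrite -uB -{2}[u]powRr1 ?(ltW u0)// -powRD ?subrK// (gt_eqF u0) implybT.
have tangent x : 0 < x ->
    alpha * (x `^ r + r * x `^ (r - 1) * (t - x)) <= alpha * t `^ r.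
  by move=> x0; rewrite ler_wpM2l ?(ltW al0)// powR_tangent.
rewrite /chord /gamma_const -/B -/u slE ur.
have cE : (M * m `^ r - m * M `^ r) / (M - m) = m `^ r - alpha * r * B * m.
  by rewrite -slE; field; rewrite gt_eqF.
have ar : alpha * r < 0 by rewrite pmulr_rlt0.
case: ifPn => [_|hu]; last case: ifPn => [Mu|Mu].
- by have := tangent u u0; rewrite cE uB; move: uBr => <-; lra.
- have chM : alpha * r * B * (M - m) = M `^ r - m `^ r.
    by rewrite -slE divfK// gt_eqF.
  have := tangent M M0; have := anti M u M0 Mu; rewrite uB => h1 h2.
  have : alpha * r * (B - M `^ (r - 1)) * (t - M) <= 0.
    rewrite mulr_ge0_le0 ?subr_le0// mulr_le0// ?subr_le0// ltW//.
  lra.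
- have um : u <= m.
    by move: hu; rewrite negb_and -!ltNge => /orP[/ltW//|/ltW Mu']; rewrite Mu' in Mu.
  have := tangent m m0; have := anti u m u0 um; rewrite uB => h1 h2.
  have : alpha * r * (B - m `^ (r - 1)) * (t - m) <= 0.
    rewrite mulr_le0_ge0 ?subr_ge0// nmulr_rle0// subr_ge0//.
  lra.
Qed.

End MondPecaric.

(** * The Hilbert space of dimension two *)

(* A copy of [R[i] * R[i]], whose library norm is the maximum norm. *)
Definition C2 (R : realType) : Type := (R[i] * R[i])%type.

HB.instance Definition _ (R : realType) := GRing.Lmodule.copy (C2 R) (R[i]^o *
  R[i]^o)%type.

Section C2Norm.
Context {R : realType}.
Implicit Types (x y z : C2 R).

Definition c2dot x y : R[i] := x.1 * Num.conj y.1 + x.2 * Num.conj y.2.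

Definition c2rdot x y : R := complex.Re x.1 * complex.Re y.1 + complex.Im x.1 *
  complex.Im y.1
  + complex.Re x.2 * complex.Re y.2 + complex.Im x.2 * complex.Im y.2.

Definition c2norm x : R[i] := (Num.sqrt (c2rdot x x))%:C.

Lemma c2rdot_ge0 x : 0 <= c2rdot x x.
Proof. by rewrite /c2rdot -!expr2 !addr_ge0 ?sqr_ge0. Qed.

Lemma c2rdot_le x y : c2rdot x y <= Num.sqrt (c2rdot x x) * Num.sqrt (c2rdot y y).
Proof.
rewrite -sqrtrM ?c2rdot_ge0//; apply: le_trans (ler_norm _) _.
rewrite -sqrtr_sqr ler_wsqrtr//.
case: x y => [[a b] [c d]] [[a' b'] [c' d']]; rewrite /c2rdot /=.
rewrite -subr_ge0 (_ : _ - _ = (a * b' - b * a') ^+ 2 + (a * c' - c * a') ^+ 2 +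
  (a * d' - d * a') ^+ 2 + (b * c' - c * b') ^+ 2 + (b * d' - d * b') ^+ 2 +
  (c * d' - d * c') ^+ 2); last by ring.
by rewrite !addr_ge0 ?sqr_ge0.
Qed.

Lemma c2normD x y : c2norm (x + y) <= c2norm x + c2norm y.
Proof.
rewrite /c2norm -rmorphD lecR -(@ler_pXn2r _ 2) ?nnegrE ?addr_ge0 ?sqrtr_ge0//.
rewrite sqr_sqrtr ?c2rdot_ge0// sqrrD !sqr_sqrtr ?c2rdot_ge0//.
have := c2rdot_le x y.
have -> : c2rdot (x + y) (x + y) = c2rdot x x + c2rdot y y + 2 * c2rdot x y.
  by case: x y => [[a b] [c d]] [[a' b'] [c' d']]; rewrite /c2rdot /=; ring.
lra.
Qed.

Lemma c2normZ (l : R[i]) x : c2norm (l *: x) = `|l| * c2norm x.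
Proof.
rewrite /c2norm normc_def -rmorphM -sqrtrM ?addr_ge0 ?sqr_ge0//.
congr (Num.sqrt _)%:C.
by case: l x => [e f] [[a b] [c d]]; rewrite /c2rdot /=; ring.
Qed.

Lemma c2norm0_eq0 x : c2norm x = 0 -> x = 0.
Proof.
move=> /complexI /eqP; rewrite sqrtr_eq0 => h.
have {h} : c2rdot x x = 0 by apply/le_anti; rewrite h c2rdot_ge0.
case: x => [[a b] [c d]]; rewrite /c2rdot /= -!expr2 => h.
have := sqr_ge0 a; have := sqr_ge0 b; have := sqr_ge0 c; have := sqr_ge0 d => h1 h2 h3 h4.
have z u : u ^+ 2 <= 0 -> u = 0 :> R.
  by move=> hu; apply/eqP; rewrite -sqrf_eq0; apply/eqP/le_anti; rewrite hu sqr_ge0.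
have -> : a = 0 by apply: z; lra.
have -> : b = 0 by apply: z; lra.
have -> : c = 0 by apply: z; lra.
by have -> : d = 0 by apply: z; lra.
Qed.

HB.instance Definition _ :=
  Lmodule_isNormed.Build R[i] (C2 R) c2normD c2normZ c2norm0_eq0.

Lemma c2normE x : `|x| = (Num.sqrt (c2rdot x x))%:C.
Proof. by []. Qed.

Definition c2coord (k : 'I_4) x : R :=
  nth 0 [:: complex.Re x.1; complex.Im x.1; complex.Re x.2; complex.Im x.2] k.

Definition c2of (u : 'I_4 -> R) : C2 R :=
  (u (inord 0) +i* u (inord 1), u (inord 2) +i* u (inord 3)).

Lemma c2coord_le k x : `|c2coord k x|%:C <= `|x|.
Proof.
rewrite c2normE lecR -sqrtr_sqr ler_wsqrtr//.
case: x => [[a b] [c d]]; rewrite /c2rdot /c2coord /= -!expr2.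
have := sqr_ge0 a; have := sqr_ge0 b; have := sqr_ge0 c; have := sqr_ge0 d => h1 h2 h3 h4.
by case: k => [[|[|[|[|]]]]] //= _; lra.
Qed.

Lemma c2norm_lt x (e : R) : 0 < e -> (forall k, `|c2coord k x| < e / 2) -> `|x| < e%:C.
Proof.
move=> e0 h; rewrite c2normE ltcR -(@ltr_pXn2r _ 2) ?nnegrE ?sqrtr_ge0 ?(ltW e0)//.
rewrite sqr_sqrtr ?c2rdot_ge0//.
have {}h k : c2coord k x ^+ 2 < e ^+ 2 / 4.
  have := h k; rewrite -(@ltr_pXn2r _ 2) ?nnegrE ?normr_ge0//;
    last by rewrite divr_ge0// ltW.
  by rewrite real_normK ?num_real// => /lt_le_trans; apply; lra.
have := h (inord 0); have := h (inord 1); have := h (inord 2); have := h (inord 3).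
rewrite /c2coord !inordK//= /c2rdot -!expr2; lra.
Qed.

Lemma c2coordB k x y : c2coord k (x - y) = c2coord k x - c2coord k y.
Proof.
by case: x y => [[a b] [c d]] [[a' b'] [c' d']]; case: k => [[|[|[|[|]]]]].
Qed.

Lemma c2ofK u k : c2coord k (c2of u) = u k.
Proof.
rewrite /c2coord /=.
by case: k => [[|[|[|[|]]]]] //= hk; congr u; apply: val_inj; rewrite /= inordK.
Qed.

Lemma c2_complete (F : set_system (C2 R)) : ProperFilter F -> cauchy F -> cvg F.
Proof.
move=> FF /cauchy_ballP Fc.
have /boolp.choice[l hl] k : exists l : R, ((c2coord k @ F) --> l)%classic.
  apply/cvg_ex; apply: cauchy_cvg; apply/cauchy_ballP => e e0.
  have eC : 0 < e%:C :> R[i] by rewrite ltcR.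
  have := Fc _ eC; move=> [[P Q] /= [FP FQ] PQ].
  exists ((c2coord k @` P)%classic, (c2coord k @` Q)%classic).
    by split=> /=; [apply: filterS FP | apply: filterS FQ] => x ?; exists x.
  move=> [_ _] /= [[x Px <-] [y Qy <-]].
  have := PQ (x, y) (conj Px Qy); rewrite /= -!ball_normE /= => h.
  by rewrite -ltcR -c2coordB; apply: le_lt_trans (c2coord_le _ _) h.
apply/cvg_ex; exists (c2of l); apply/cvgrPdist_lt => e e0.
have eR : e = (complex.Re e)%:C by rewrite RRe_real// gtr0_real.
have e0' : 0 < complex.Re e by rewrite -ltcR -eR.
have : \forall x \near F, forall k, `|l k - c2coord k x| < complex.Re e / 2.
  apply: filter_forall => k; have /cvgrPdist_lt := hl k; apply.
  by rewrite divr_gt0.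
apply: filterS => x h; rewrite eR; apply: c2norm_lt => // k.
by rewrite c2coordB c2ofK.
Qed.

HB.instance Definition _ := Uniform_isComplete.Build (C2 R) c2_complete.

Lemma c2dot_linearl (a : R[i]) x y z : c2dot (a *: x + y) z = a * c2dot x z + c2dot y z.
Proof. by rewrite /c2dot /= !mulrDl mulrDr !mulrA addrACA. Qed.

Lemma c2dotC x y : c2dot x y = Num.conj (c2dot y x).
Proof.
case: x y => [[a b] [c d]] [[a' b'] [c' d']]; apply/eqP.
by rewrite eq_complex /c2dot /=; apply/andP; split; apply/eqP; ring.
Qed.

Lemma c2dot_norm x : `|x| ^+ 2 = c2dot x x.
Proof.
rewrite c2normE -rmorphXn sqr_sqrtr ?c2rdot_ge0//.
case: x => [[a b] [c d]]; apply/eqP; rewrite eq_complex /c2dot /c2rdot /=.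
by apply/andP; split; apply/eqP; ring.
Qed.

HB.instance Definition _ := CompleteNormedModule_isHilbert.Build R (C2 R)
  c2dot_linearl c2dotC c2dot_norm.

End C2Norm.

Section C2Operators.
Context {R : realType}.
Implicit Types (x y z : C2 R) (a b c s : R) (f : R -> R).

Lemma c2_rdotE x y : rdot x y = c2rdot x y.
Proof.
rewrite /rdot /hdot /=.
by case: x y => [[a b] [c d]] [[a' b'] [c' d']]; rewrite /c2dot /c2rdot /=; ring.
Qed.

Lemma c2op_exists p q l : exists T : 'B(C2 R), forall x,
  T x = (p%:C * x.1 + q%:C * x.2, q%:C * x.1 + l%:C * x.2).
Proof.
pose f x : C2 R := (p%:C * x.1 + q%:C * x.2, q%:C * x.1 + l%:C * x.2).
(* The Frobenius norm; the defect in the squared bound is a sum of squares by Lagrange's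
   identity. *)
apply: (@mk_bop _ _ f (Num.sqrt (p ^+ 2 + q ^+ 2 + q ^+ 2 + l ^+ 2))).
  move=> k x y; congr (_, _); rewrite /= /GRing.scale /=; ring.
move=> x; rewrite -(@ler_pXn2r _ 2) ?nnegrE ?mulr_ge0 ?sqrtr_ge0 ?nrm_ge0//.
rewrite exprMn !sqr_nrm sqr_sqrtr; last by rewrite !addr_ge0 ?sqr_ge0.
rewrite !c2_rdotE /f; case: x => [[a b] [c d]]; rewrite /c2rdot /=.
rewrite -subr_ge0 (_ : _ - _ = (q * a - p * c) ^+ 2 + (q * b - p * d) ^+ 2 +
  (l * a - q * c) ^+ 2 + (l * b - q * d) ^+ 2); last by ring.
by rewrite !addr_ge0 ?sqr_ge0.
Qed.

Definition c2op p q l : 'B(C2 R) := projT1 (cid (c2op_exists p q l)).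

Lemma c2opE p q l x : c2op p q l x = (p%:C * x.1 + q%:C * x.2, q%:C * x.1 + l%:C * x.2).
Proof. exact: projT2 (cid (c2op_exists p q l)) x. Qed.

Lemma c2op_selfadj p q l : selfadj (c2op p q l).
Proof.
move=> x y; rewrite !c2opE !c2_rdotE.
by case: x y => [[a b] [c d]] [[a' b'] [c' d']]; rewrite /c2rdot /=; ring.
Qed.

Lemma c2op_quad p q l x : rdot (c2op p q l x) x =
  p * complex.Re x.1 ^+ 2 + 2 * q * complex.Re x.1 * complex.Re x.2 + l * complex.Re
    x.2 ^+ 2 +
  (p * complex.Im x.1 ^+ 2 + 2 * q * complex.Im x.1 * complex.Im x.2 + l * complex.Im
    x.2 ^+ 2).
Proof.
rewrite c2opE c2_rdotE.
by case: x => [[a b] [c d]]; rewrite /c2rdot /=; ring.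
Qed.

(** The hypothesis says that the two symmetric matrices commute, which makes their product symmetric
    and thus again a [c2op]. *)
Lemma c2op_mul p q l p' q' l' : p * q' + q * l' = q * p' + l * q' ->
  c2op p q l * c2op p' q' l' = c2op (p * p' + q * q') (p * q' + q * l') (q * q' + l * l').
Proof.
move=> e; apply: bop_ext => x; rewrite mulopE !c2opE /=; congr (_, _).
  by rewrite !rmorphD !rmorphM /=; ring.
by rewrite e !rmorphD !rmorphM /=; ring.
Qed.

Lemma c2op_add p q l p' q' l' : c2op p q l + c2op p' q' l' = c2op (p + p') (q + q') (l
  + l').
Proof.
apply: bop_ext => x; rewrite addopE !c2opE; congr (_, _); rewrite !rmorphD /=; ring.
Qed.

Lemma c2op_scalar k : c2op k 0 k = k%:C *: (1 : 'B(C2 R)).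
Proof.
by apply: bop_ext => -[x1 x2]; rewrite c2opE !opE; congr (_, _);
  rewrite /= rmorph0 /GRing.scale /=; ring.
Qed.

(** The left matrix of [rotated_le]: for [c^2 + s^2 = 1], eigenvalue [a] on [(c, s)] and [b] on
    [(- s, c)]. *)
Definition rotop a b c s := c2op (c ^+ 2 * a + s ^+ 2 * b) (c * s * (a - b))
  (s ^+ 2 * a + c ^+ 2 * b).

Section Rotation.
Context {c s : R} (cs : c ^+ 2 + s ^+ 2 = 1).

Lemma rotop_mul a b a' b' : rotop a b c s * rotop a' b' c s = rotop (a * a') (b * b') c s.
Proof.
rewrite /rotop c2op_mul.
  congr c2op.
  - rewrite [LHS](_ : _ = c ^+ 2 * (a * a') * (c ^+ 2 + s ^+ 2) + s ^+ 2 * (b * b') *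
    (c ^+ 2 + s ^+ 2)).
      by rewrite cs !mulr1.
    by ring.
  - rewrite [LHS](_ : _ = c * s * (a * a' - b * b') * (c ^+ 2 + s ^+ 2)); last by ring.
    by rewrite cs mulr1.
  - rewrite [LHS](_ : _ = s ^+ 2 * (a * a') * (c ^+ 2 + s ^+ 2) + c ^+ 2 * (b * b') *
    (c ^+ 2 + s ^+ 2)).
      by rewrite cs !mulr1.
    by ring.
by ring.
Qed.

Lemma rotop_add a b a' b' : rotop a b c s + rotop a' b' c s = rotop (a + a') (b + b') c s.
Proof. by rewrite /rotop c2op_add; congr c2op; ring. Qed.

Lemma rotop_scalar k : rotop k k c s = k%:C *: (1 : 'B(C2 R)).
Proof.
rewrite -c2op_scalar /rotop; congr c2op; last first.
- by rewrite -mulrDl addrC cs mul1r.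
- by rewrite subrr mulr0.
- by rewrite -mulrDl cs mul1r.
Qed.

Lemma rotop_inverse a b : a != 0 -> b != 0 -> is_inverse (rotop a b c s) (rotop a^-1
  b^-1 c s).
Proof.
by move=> a0 b0; split; rewrite rotop_mul ?divff ?mulVf// rotop_scalar scale1r.
Qed.

Lemma rotop_spectrum a b t : spectrum (rotop a b c s) t%:C -> t = a \/ t = b.
Proof.
have [->|ta] := eqVneq t a; first by left.
have [->|tb] := eqVneq t b; first by right.
case; rewrite -scaleN1r scalerA mulN1r -rmorphN -rotop_scalar rotop_add.
exists (rotop (a - t)^-1 (b - t)^-1 c s).
by apply: rotop_inverse; rewrite subr_eq0 eq_sym.
Qed.

Lemma rotop_poly (p : {poly R}) a b : poly_op p (rotop a b c s) = rotop p.[a] p.[b] c s.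
Proof.
elim/poly_ind: p => [|p k IH].
  by rewrite -[0]/(0%:P) poly_opC !hornerC rotop_scalar.
by rewrite poly_opD poly_opM poly_opX poly_opC IH rotop_mul -rotop_scalar rotop_add
  !hornerMXaddC.
Qed.

Lemma rotop_cfc f a b : cfc f (rotop a b c s) = rotop (f a) (f b) c s.
Proof.
apply: cfcE; first exact: c2op_selfadj.
(* The spectrum contains at most [a] and [b], so linear interpolation computes [f] exactly; for
   [a = b] it is constant. *)
pose p : {poly R} := (f a)%:P + ((f b - f a) / (b - a)) *: ('X - a%:P).
have pa : p.[a] = f a by rewrite !hornerE subrr mulr0 addr0.
have pb : p.[b] = f b.
  have [<-//|ba] := eqVneq a b; rewrite !hornerE divfK; first by rewrite addrC subrK.
  by rewrite subr_eq0 eq_sym.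
have := is_cfc_poly p (rotop a b c s); rewrite rotop_poly pa pb.
by apply: is_cfc_ext => t /rotop_spectrum[] ->.
Qed.

Lemma rotop_quad a b x : rdot (rotop a b c s x) x =
  a * (c * complex.Re x.1 + s * complex.Re x.2) ^+ 2 +
  b * (- s * complex.Re x.1 + c * complex.Re x.2) ^+ 2 +
  (a * (c * complex.Im x.1 + s * complex.Im x.2) ^+ 2 +
   b * (- s * complex.Im x.1 + c * complex.Im x.2) ^+ 2).
Proof. by rewrite c2op_quad; ring. Qed.

Lemma rotop_pos_inv a b : 0 < a -> 0 < b -> pos_inv (rotop a b c s).
Proof.
move=> a0 b0; split; last first.
  by exists (rotop a^-1 b^-1 c s); apply: rotop_inverse; rewrite gt_eqF.
apply/positive_opP; split; first exact: c2op_selfadj.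
by move=> x; rewrite rotop_quad !addr_ge0// mulr_ge0 ?sqr_ge0 ?ltW.
Qed.

End Rotation.

(** The form of a real symmetric matrix at a complex vector is the sum of its values at the real and
    imaginary parts, so real test vectors suffice. *)
Lemma rotated_leP a b c s p l :
  rotated_le a b c s p l <-> rotop a b c s <=op rotop p l 1 0.
Proof.
split=> [h|h x y].
  apply: quad_leop; [exact: c2op_selfadj | exact: c2op_selfadj | move=> x].
  rewrite !rotop_quad !(mul1r, mul0r, oppr0, addr0, add0r).
  by rewrite lerD ?h.
have := leop_quad ((x%:C, y%:C) : C2 R) h; rewrite !rotop_quad /=.
by rewrite !(mul1r, mul0r, mulr0, oppr0, addr0, add0r, expr0n).
Qed.

Lemma operator_monotone_two f : operator_monotone f -> two_monotone f.
Proof.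
move=> [_ fm] a b c s p l a0 b0 p0 l0 cs /rotated_leP h; apply/rotated_leP.
have i : (1 : R) ^+ 2 + 0 ^+ 2 = 1 by rewrite expr1n expr0n addr0.
rewrite -(rotop_cfc cs) -(rotop_cfc i).
by apply: fm => //; apply: rotop_pos_inv.
Qed.

End C2Operators.

(** * Means represented by a function *)

Section KuboAndo.
Context {R : realType} {H : hilbertType R}.
Implicit Types (x y z : H) (a b c d e t r s : R) (A B C S T X : 'B(H)).

Lemma leop_scalar_quad A c x : c%:C *: (1 : 'B(H)) <=op A -> c * rdot x x <= rdot (A x) x.
Proof. by move=> /(leop_quad x); rewrite !opE rdotZl. Qed.

Lemma quad_scalar_leop A c : selfadj A -> (forall x, c * rdot x x <= rdot (A x) x) ->
  c%:C *: (1 : 'B(H)) <=op A.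
Proof.
move=> a h; apply: quad_leop => // [|x]; first exact: selfadjZ.
by rewrite !opE rdotZl.
Qed.

Lemma pos_inv_scalar c : 0 < c -> pos_inv (c%:C *: (1 : 'B(H))).
Proof.
move=> c0; apply: (@bounds_pos_inv _ _ _ c) => // [|x]; first exact: selfadjZ.
by rewrite !opE rdotZl.
Qed.

Lemma scalar_opV c : c != 0 -> c%:C *: (1 : 'B(H)) * (c^-1%:C *: (1 : 'B(H))) = 1.
Proof.
move=> c0; rewrite scalemulopl scalemulopr mulr1 scalerA -rmorphM divff//.
by rewrite rmorph1 scale1r.
Qed.

Lemma op_in_inv a b A B : 0 < a -> 0 < b -> op_in a b A -> A * B = 1 -> op_in b^-1 a^-1 B.
Proof.
move=> a0 b0 hA AB; have hi := op_in_pos_inv a0 hA; have [sa aA Ab] := hA.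
have hB := pos_inv_inverse hi AB; split; first exact: pos_inv_selfadj.
- move=> x; apply: leop_scalar_quad.
  apply: leop_inv hi (pos_inv_scalar b0) AB _ _; first by rewrite scalar_opV// gt_eqF.
  apply: quad_leop => //; first exact: selfadjZ.
  by move=> x'; rewrite !opE rdotZl.
- move=> x; have := @leop_inv _ _ _ A _ B (pos_inv_scalar a0) hi _ AB (quad_scalar_leop
  sa aA).
  move=> /(_ _ (scalar_opV (lt0r_neq0 a0)))/(leop_quad x).
  by rewrite !opE rdotZl.
Qed.

Lemma pos_inv_conj S A : pos_inv S -> pos_inv A -> pos_inv (S * A * S).
Proof.
move=> hS [/positive_opP[a A0] iA]; have s := pos_inv_selfadj hS; split; last first.
  by apply: invertibleM; [apply: invertibleM => //|]; case: hS.
apply/positive_opP; split; first exact: selfadj_conj.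
by move=> x; rewrite !mulopE s.
Qed.

Lemma conj_cancel P N A : P * N = 1 -> N * P = 1 -> P * (N * A * N) * P = A.
Proof. by move=> PN NP; rewrite !mulrA PN mul1r -mulrA NP mulr1. Qed.

Lemma conj_cancel_mul P N A B : P * N = 1 -> A * B = 1 -> P * A * P * (N * B * N) = 1.
Proof. by move=> PN AB; rewrite -!mulrA (mulrA P N) PN mul1r (mulrA A) AB mul1r. Qed.

Lemma conj_affine P T k (l : R[i]) : P * (k *: (1 : 'B(H)) + l *: T) * P = k *: (P * P)
  + l *: (P * T * P).
Proof. by rewrite mulrDr mulrDl !scalemulopr !scalemulopl mulr1. Qed.

Lemma right_inverse_unique A B : pos_inv A -> A * B = 1 -> inv_op A = B.
Proof.
move=> hA AB; have [_ h] := inv_opP (proj2 hA).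
by rewrite -[LHS]mulr1 -AB mulrA h mul1r.
Qed.

Lemma cfc_mul_eq1 (f g : R -> R) T F G : pos_inv T -> is_cfc f T F -> is_cfc g T G ->
  (forall t, 0 < t -> f t * g t = 1) -> F * G = 1.
Proof.
move=> hT hF hG fg; rewrite -(pow_op0 hT).
apply: (pow_op_uniq hT (is_cfcM (pos_inv_selfadj hT) hF hG)) => t /fg ->.
by rewrite powRr0.
Qed.

Section Representation.
Context {f : R -> R} (fc : forall t, 0 < t -> {for t, continuous f})
  (fp : forall t, 0 < t -> 0 < f t) {X A : 'B(H)} (hX : pos_inv X) (hA : pos_inv A).

Let P := pow_op X 2^-1.
Let N := pow_op X (- 2^-1).
Let T := N * A * N.

Definition function_mean := P * cfc f T * P.

Let hP : pos_inv P. Proof. exact: pow_op_pos_inv. Qed.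
Let hN : pos_inv N. Proof. exact: pow_op_pos_inv. Qed.
Let hT : pos_inv T. Proof. exact: pos_inv_conj. Qed.
Let PN : P * N = 1. Proof. exact: pow_opV. Qed.
Let NP : N * P = 1. Proof. by rewrite /N /P pow_opD// addNr pow_op0. Qed.
Let PP : P * P = X.
Proof. by rewrite /P pow_opD// (_ : 2^-1 + 2^-1 = 1) ?pow_op1//; field. Qed.
Let NN : N * N = inv_op X.
Proof. by rewrite /N pow_opD// (_ : - 2^-1 + - 2^-1 = - 1) ?pow_opN1//; field. Qed.
Let PTP : P * T * P = A. Proof. exact: conj_cancel. Qed.
Let Fc : is_cfc f T (cfc f T). Proof. exact: cfc_pos_invP. Qed.

Let gc t : 0 < t -> {for t, continuous (fun t => (f t)^-1)}.
Proof. by move=> t0; apply: continuousV; [rewrite gt_eqF ?fp | exact: fc]. Qed.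
Let Gc : is_cfc (fun t => (f t)^-1) T (cfc (fun t => (f t)^-1) T).
Proof. exact: cfc_pos_invP. Qed.

Let FG : cfc f T * cfc (fun t => (f t)^-1) T = 1.
Proof. by apply: (cfc_mul_eq1 hT Fc Gc) => t /fp t0; rewrite divff// gt_eqF. Qed.

Let GF : cfc (fun t => (f t)^-1) T * cfc f T = 1.
Proof. by apply: (cfc_mul_eq1 hT Gc Fc) => t /fp t0; rewrite mulVf// gt_eqF. Qed.

Let hF : pos_inv (cfc f T).
Proof.
have st := pos_inv_selfadj hT; split; last by exists (cfc (fun t => (f t)^-1) T).
apply/positive_opP; split; first exact: is_cfc_selfadj Fc.
by apply: (is_cfc_psd st Fc) => t /(pos_inv_spectrum hT)/fp/ltW.
Qed.

Lemma function_mean_pos_inv : pos_inv function_mean.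
Proof. exact: pos_inv_conj. Qed.

(** The scalar bound gives [f(T) <= (1 - s) + s T]; conjugation by [P] sends [1] to [X] and [T] to
    [A]. *)
Lemma function_mean_le s : (forall t, 0 < t -> f t <= 1 + s * (t - 1)) ->
  function_mean <=op X + s%:C *: (A - X).
Proof.
move=> fs; have st := pos_inv_selfadj hT.
have h : cfc f T <=op (1 - s)%:C *: (1 : 'B(H)) + s%:C *: T.
  have := is_cfc_poly ((1 - s)%:P + s *: 'X) T.
  rewrite poly_opD poly_opZ poly_opX poly_opC => hp;
    apply: is_cfc_mono st Fc hp _ => t /(pos_inv_spectrum hT)/fs.
  by rewrite !hornerE; lra.
have := leop_conj (pos_inv_selfadj hP) h; rewrite conj_affine PP PTP.
by rewrite rmorphB rmorph1 scalerBl scale1r scalerBr addrAC addrA.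
Qed.

(** The inverse of the mean is [N (1 / f)(T) N], and conjugation by [N] sends [1] to the inverse of
    [X] and the inverse of [T] to that of [A]. *)
Lemma function_mean_inv_le s : (forall t, 0 < t -> (f t)^-1 <= 1 + s * (t^-1 - 1)) ->
  inv_op function_mean <=op inv_op X + s%:C *: (inv_op A - inv_op X).
Proof.
move=> fs; have st := pos_inv_selfadj hT.
have [AA AA'] := inv_opP (proj2 hA).
have -> : inv_op function_mean = N * cfc (fun t => (f t)^-1) T * N.
  by apply: right_inverse_unique function_mean_pos_inv _; exact: conj_cancel_mul.
have TV : pow_op T (- 1) = P * inv_op A * P.
  by rewrite pow_opN1//; apply: right_inverse_unique hT _; exact: conj_cancel_mul.
have h : cfc (fun t => (f t)^-1) T <=op
    (1 - s)%:C *: (1 : 'B(H)) + s%:C *: pow_op T (- 1).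
  rewrite -(poly_opC _ T).
  apply: is_cfc_mono st Gc (is_cfcD (is_cfc_poly _ _) (is_cfcZ s (pow_opP _ hT))) _.
  move=> t /(pos_inv_spectrum hT) t0; rewrite hornerC powR_inv1 ?(ltW t0)//.
  by have := fs _ t0; lra.
rewrite TV in h; have := leop_conj (pos_inv_selfadj hN) h.
rewrite conj_affine NN (conj_cancel _ NP PN).
by rewrite rmorphB rmorph1 scalerBl scale1r scalerBr addrAC addrA.
Qed.

End Representation.

Lemma quad_sum n (w : 'I_n -> R) (F : 'I_n -> 'B(H)) x :
  rdot ((\sum_(j < n) (w j)%:C *: F j) x) x = \sum_(j < n) w j * rdot (F j x) x.
Proof.
elim/big_rec2 : _ => [|j y1 y2 _ IH]; first by rewrite opE rdot0l.
by rewrite addopE rdotDl IH scaleopE rdotZl.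
Qed.

Lemma selfadj_wsum n (w : 'I_n -> R) (F : 'I_n -> 'B(H)) :
  (forall j, selfadj (F j)) -> selfadj (\sum_(j < n) (w j)%:C *: F j).
Proof. by move=> h; apply: selfadj_sum => j; exact: selfadjZ. Qed.

Lemma quad_wsum_affine n (w : 'I_n -> R) (F : 'I_n -> 'B(H)) (u v : R) x : 
  \sum_(j < n) w j = 1 ->
  \sum_(j < n) w j * (u + v * rdot (F j x) x) =
    u + v * rdot ((\sum_(j < n) (w j)%:C *: F j) x) x.
Proof.
move=> w1; rewrite quad_sum mulr_sumr.
under eq_bigr do rewrite mulrDr mulrCA.
by rewrite big_split /= -mulr_suml w1 mul1r.
Qed.

Lemma pos_inv_wsum n (w : 'I_n -> R) (F : 'I_n -> 'B(H)) : probability_vector w ->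
  (forall j, pos_inv (F j)) -> pos_inv (\sum_(j < n) (w j)%:C *: F j).
Proof.
move=> [w0 w1] hF.
(* Weights may vanish, but not all; one positive weight already gives a lower bound. *)
have [j wj] : exists j, 0 < w j.
  apply: contrapT => h; have : \sum_(j < n) w j = 0.
    apply: big1 => j _; apply/le_anti; rewrite w0 andbT leNgt; apply/negP => wj.
    by apply: h; exists j.
  by rewrite w1 => /eqP; rewrite oner_eq0.
have [c [_ [c0 _ cF _]]] := pos_inv_bounds (hF j).
apply: (@bounds_pos_inv _ _ _ (w j * c)); last first.
- move=> x; rewrite quad_sum (bigD1 j)//= -[leLHS]addr0 -mulrA; apply: lerD.
    by rewrite ler_wpM2l ?w0.
  apply: sumr_ge0 => i _; rewrite mulr_ge0 ?w0//.
  by have /positive_opP[_] := proj1 (hF i); apply.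
- by rewrite mulr_gt0.
by apply: selfadj_wsum => i; exact: pos_inv_selfadj.
Qed.

End KuboAndo.

Arguments function_mean {R H} f X A.

Section LeftTrivial.
Context {R : realType}.

(** The representation only covers invertible arguments. Adding [1 / (k + 1)] makes positive ones
    invertible, and continuity along decreasing sequences carries [sigma A B = A] to the limit. *)
Lemma represents_const_left_trivial (f : R -> R)
    (sigma : forall L : hilbertType R, 'B(L) -> 'B(L) -> 'B(L)) :
  (forall H, kubo_ando_axioms (sigma H)) -> (forall H, represents f (sigma H)) ->
  (forall t, 0 < t -> f t = 1) -> left_trivial_mean sigma.
Proof.
move=> hk hr f1 H A B A0 B0.
pose e k : R := k.+1%:R^-1; have e0 k : 0 < e k by rewrite invr_gt0.
pose reg (C : 'B(H)) k := C + (e k)%:C *: (1 : 'B(H)).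
have reg_pos C k : positive_op C -> pos_inv (reg C k).
  move=> /positive_opP[c C0]; apply: (@bounds_pos_inv _ _ _ (e k)) => //.
    by apply: selfadjD => //; exact: selfadjZ.
  by move=> x; rewrite /reg !opE !rdotE lerDr.
have reg_cvg C : sot_cvg (reg C) C.
  move=> x; apply/cvgrPdist_le => d d0.
  have dR : d = (complex.Re d)%:C by rewrite RRe_real// gtr0_real.
  have d0' : 0 < complex.Re d by rewrite -ltcR -dR.
  exists (Num.truncn (nrm x / complex.Re d)) => // k Nk.
  rewrite /reg !opE opprD addNKr normrN nrmE nrmZ dR lecR gtr0_norm// mulrC.
  rewrite ler_pdivrMr// mulrC -ler_pdivrMr//; apply: ltW.
  by apply: lt_le_trans (truncnS_gt _) _; rewrite ler_nat.
have reg_decr C : positive_op C -> sot_decr (reg C) C.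
  move=> C0; split=> // k; apply: quad_leop => [||x].
  - exact: pos_inv_selfadj (reg_pos _ _ C0).
  - exact: pos_inv_selfadj (reg_pos _ _ C0).
  - rewrite /reg !opE !rdotE lerD2l ler_wpM2r ?rdot_ge0//.
    by rewrite lef_pV2 ?posrE ?ltr0n// ler_nat.
have [_ cv] := @mean_continuous _ _ _ (hk H) _ _ _ _
  (fun k => proj1 (reg_pos A k A0)) (fun k => proj1 (reg_pos B k B0)) A0 B0
  (reg_decr A A0) (reg_decr B B0).
have regE k : sigma H (reg A k) (reg B k) = reg A k.
  have hA := reg_pos A k A0; have hB := reg_pos B k B0.
  rewrite hr//; set T := pow_op _ (- 2^-1) * _ * _.
  have hT : pos_inv T by apply: pos_inv_conj => //; exact: pow_op_pos_inv.
  have -> : cfc f T = 1.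
    apply: cfcE; first exact: pos_inv_selfadj.
    apply: (@is_cfc_ext _ _ (horner 1%:P)).
      by move=> t /(pos_inv_spectrum hT)/f1 ->; rewrite hornerC.
    by have := is_cfc_poly 1%:P T; rewrite poly_opC scale1r.
  by rewrite mulr1 pow_opD// (_ : 2^-1 + 2^-1 = 1) ?pow_op1//; field.
apply: bop_ext => x; have h1 := cv x; have h2 := reg_cvg A x.
have h3 : ((fun k => reg A k x) @ \oo --> sigma H A B x)%classic.
  by move: h1; under eq_fun do rewrite regE.
exact: (cvg_unique (@norm_hausdorff _ H) h3 h2).
Qed.

End LeftTrivial.

(** * The deformed mean *)

Lemma pos_inv_inv_op (R : realType) (H : hilbertType R) (A : 'B(H)) :
  pos_inv A -> pos_inv (inv_op A).
Proof. by move=> hA; have [h _] := inv_opP (proj2 hA); exact: pos_inv_inverse hA h. Qed.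

Section DeformedMean.
Context {R : realType}.

Lemma operator_mean_tangents
    (sigma : forall L : hilbertType R, 'B(L) -> 'B(L) -> 'B(L)) :
  operator_mean sigma -> ~ left_trivial_mean sigma ->
  exists f : R -> R, [/\ forall t, 0 < t -> {for t, continuous f},
    forall t, 0 < t -> 0 < f t, forall H, represents f (sigma H),
    exists2 s : R, 0 < s & forall t, 0 < t -> f t <= 1 + s * (t - 1) &
    exists2 s : R, 0 < s & forall t, 0 < t -> (f t)^-1 <= 1 + s * (t^-1 - 1)].
Proof.
move=> [hk [f [fm f0 f1 hr]]] nl; have fm2 := operator_monotone_two fm.
have fc t : 0 < t -> {for t, continuous f}.
  by move=> t0; apply: (proj1 fm); rewrite in_itv /= t0.
have fn : exists2 t : R, 0 < t & f t != 1.
  apply: contrapT => h; apply: nl; apply: represents_const_left_trivial hk hr _.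
  by move=> t t0; apply: contrapT => /eqP ft; apply: h; exists t.
exists f; split=> //.
- exact: two_monotone_gt0.
- exact: two_monotone_tangent.
- exact: two_monotone_harmonic_tangent.
Qed.

Context {H : hilbertType R} {n : nat} {w : 'I_n -> R} (hw : probability_vector w)
  {f : R -> R} (fc : forall t, 0 < t -> {for t, continuous f})
  (fp : forall t, 0 < t -> 0 < f t)
  {sigma : 'B(H) -> 'B(H) -> 'B(H)} (hs : represents f sigma)
  {M Ms : ('I_n -> 'B(H)) -> 'B(H)} (hM : between_harm_arith w M)
  (hMs : is_deformed_mean M sigma Ms)
  {A : 'I_n -> 'B(H)} (hA : forall j, pos_inv (A j)).

Let X := Ms A.

Let hX : pos_inv X. Proof. by have [[]] := hMs hA. Qed.

Let XE : X = M (fun j => function_mean f X (A j)).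
Proof.
have [[_ e] _] := hMs hA; rewrite {1}/X {1}e; congr M; apply/funext => j.
exact: hs.
Qed.

Let hXA j : pos_inv (function_mean f X (A j)).
Proof. exact: function_mean_pos_inv. Qed.

Lemma deformed_le_arith (s : R) : 0 < s -> (forall t, 0 < t -> f t <= 1 + s * (t - 1)) ->
  X <=op arith_mean w A.
Proof.
move=> s0 fs; have [w0 w1] := hw; have sX := pos_inv_selfadj hX.
have sA j := pos_inv_selfadj (hA j).
apply: quad_leop => // [|x]; first exact: selfadj_wsum.
have [_ h] := hM hXA; have {h} := leop_quad x h; rewrite -XE /arith_mean quad_sum => h.
have {h} : rdot (X x) x <= \sum_(j < n) w j * ((1 - s) * rdot (X x) x + s * rdot (A j
  x) x).
  apply: le_trans h _; apply: ler_sum => j _; rewrite ler_wpM2l//.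
  have := leop_quad x (function_mean_le fc hX (hA j) fs).
  by rewrite !opE !rdotE; lra.
rewrite quad_wsum_affine// -/(arith_mean w A) => h.
by rewrite -(ler_pM2l s0); lra.
Qed.

(** The cancellation of [deformed_le_arith], carried out on inverses: [H_w <= M] bounds the inverse
    of [X] by the weighted sum of the inverses of the [X sigma A j]. *)
Lemma harm_le_deformed (s : R) : 0 < s ->
  (forall t, 0 < t -> (f t)^-1 <= 1 + s * (t^-1 - 1)) -> harm_mean w A <=op X.
Proof.
move=> s0 fs; have [w0 w1] := hw.
have hS (B : 'I_n -> 'B(H)) : (forall j, pos_inv (B j)) ->
    pos_inv (\sum_(j < n) (w j)%:C *: inv_op (B j)).
  by move=> hB; apply: pos_inv_wsum => // j; exact: pos_inv_inv_op.
have hY := hS _ hA; set Y := \sum_(j < n) _ in hY.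
have [h _] := hM hXA; rewrite -XE /harm_mean in h.
have hZ := hS _ hXA; set Z := \sum_(j < n) _ in hZ h.
have [ZZ ZZ'] := inv_opP (proj2 hZ); have [XX XX'] := inv_opP (proj2 hX).
have [YY YY'] := inv_opP (proj2 hY).
have {}h : inv_op X <=op Z := leop_inv (pos_inv_inv_op hZ) hX ZZ' XX h.
have {}h : inv_op X <=op Y.
  apply: quad_leop => [||x];
    [exact: pos_inv_selfadj (pos_inv_inv_op hX)|exact: pos_inv_selfadj|].
  have {h} := leop_quad x h; rewrite /Z quad_sum => h.
  have {h} : rdot (inv_op X x) x <=
      \sum_(j < n) w j * ((1 - s) * rdot (inv_op X x) x + s * rdot (inv_op (A j) x) x).
    apply: le_trans h _; apply: ler_sum => j _; rewrite ler_wpM2l//.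
    have := leop_quad x (function_mean_inv_le fc fp hX (hA j) fs).
    by rewrite !opE !rdotE; lra.
  rewrite quad_wsum_affine// -/Y => h.
  by rewrite -(ler_pM2l s0); lra.
exact: leop_inv (pos_inv_inv_op hX) hY XX' YY h.
Qed.

End DeformedMean.

(** * The Mond-Pecaric comparison for operators *)

Section Converse.
Context {R : realType} {H : hilbertType R}.

(** In the variable [1 / t] the power [t^r] lies below the affine [k + sl / t], so the weighted sum
    of the [A j ^ r] is at most [k + sl Y], which no longer involves the individual [A j]. *)
Lemma arith_pow_le_harm n (w : 'I_n -> R) (A : 'I_n -> 'B(H)) (m M alpha r : R) :
  probability_vector w -> 0 < m -> m < M -> 0 < alpha -> 0 < r ->
  (forall j, op_in m M (A j)) ->
  arith_mean w (fun j => pow_op (A j) r) <=op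
    alpha%:C *: pow_op (harm_mean w A) r
    + (gamma_const M^-1 m^-1 (- r) alpha)%:C *: (1 : 'B(H)).
Proof.
move=> hw m0 mM al0 r0 hAin; have [w0 w1] := hw.
have M0 : 0 < M := lt_trans m0 mM.
have hA j : pos_inv (A j) := op_in_pos_inv m0 (hAin j).
have r0' : - r < 0 by rewrite oppr_lt0.
have mi0 : 0 < M^-1 by rewrite invr_gt0.
have miM : M^-1 < m^-1 by rewrite ltf_pV2.
have inv_pow t : 0 < t -> t^-1 `^ (- r) = t `^ r.
  by move=> t0; rewrite -powR_inv1 ?(ltW t0)// -powRrM mulrNN mul1r.
have inv_itv t : m <= t <= M -> M^-1 <= t^-1 <= m^-1.
  move=> /andP[mt tM]; have t0 := lt_le_trans m0 mt.
  by rewrite !lef_pV2 ?posrE// mt tM.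
set sl := (m^-1 `^ (- r) - M^-1 `^ (- r)) / (m^-1 - M^-1).
set k := M^-1 `^ (- r) - sl * M^-1.
have chE t : chord M^-1 m^-1 (- r) t = k + sl * t by rewrite /chord /k -/sl; ring.
have inAV j : op_in M^-1 m^-1 (inv_op (A j)).
  by apply: op_in_inv (hAin j) _ => //; exact: (proj1 (inv_opP (proj2 (hA j)))).
set Y := \sum_(j < n) (w j)%:C *: inv_op (A j).
have inY : op_in M^-1 m^-1 Y.
  split; first by apply: selfadj_wsum => j; have [] := inAV j.
  - move=> x; rewrite quad_sum -[leLHS]mul1r -w1 mulr_suml; apply: ler_sum => j _.
    by rewrite ler_wpM2l//; have [_ + _] := inAV j; apply.
  - move=> x; rewrite quad_sum -[leRHS]mul1r -w1 mulr_suml; apply: ler_sum => j _.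
    by rewrite ler_wpM2l//; have [_ _ +] := inAV j; apply.
have hY : pos_inv Y := op_in_pos_inv mi0 inY.
have [YZ ZY] := inv_opP (proj2 hY).
have -> : harm_mean w A = inv_op Y by [].
set Z := inv_op Y in YZ ZY *.
have inZ : op_in m M Z.
  by have := op_in_inv mi0 _ inY YZ; rewrite !invrK; apply; rewrite invr_gt0.
have hZ : pos_inv Z := op_in_pos_inv m0 inZ.
have YE : pow_op Z (- 1) = Y by rewrite pow_opN1//; exact: inv_op_eq.
apply: (@leop_trans _ _ _ (k%:C *: (1 : 'B(H)) + sl%:C *: Y)).
  apply: quad_leop => [||x].
  - by apply: selfadj_wsum => j; exact: pow_op_selfadj.
  - by apply: selfadjD; apply: selfadjZ => //; exact: pos_inv_selfadj.
  rewrite /arith_mean quad_sum !opE !rdotE.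
  apply: (@le_trans _ _ (\sum_(j < n) w j * (k * rdot x x + sl * rdot (inv_op (A j) x)
    x))).
    apply: ler_sum => j _; rewrite ler_wpM2l//.
    have sA := pos_inv_selfadj (hA j).
    have := is_cfc_mono sA (pow_opP r (hA j))
      (is_cfcD (is_cfc_poly k%:P _) (is_cfcZ sl (pow_opP (- 1) (hA j)))).
    rewrite poly_opC pow_opN1// => h; have {h} := leop_quad x (h _).
    rewrite !opE !rdotE; apply => t /(op_in_spectrum (hAin j)) mtM.
    have t0 : 0 < t by apply: lt_le_trans m0 _; case/andP: mtM.
    rewrite hornerC powR_inv1 ?(ltW t0)// -chE -inv_pow//.
    by apply: powR_le_chord => //; exact: inv_itv.
  by rewrite quad_wsum_affine.
(* Once [Y] is a power of [Z], both sides are functions of one operator and a scalar inequality on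
   its spectrum decides. *)
rewrite -YE -(poly_opC k Z) -(poly_opC _ Z).
apply: (is_cfc_mono (pos_inv_selfadj hZ)
  (is_cfcD (is_cfc_poly _ _) (is_cfcZ _ (pow_opP _ hZ)))
  (is_cfcD (is_cfcZ _ (pow_opP _ hZ)) (is_cfc_poly _ _))).
move=> t /(op_in_spectrum inZ) mtM.
have t0 : 0 < t by apply: lt_le_trans m0 _; case/andP: mtM.
rewrite !hornerC powR_inv1 ?(ltW t0)// -chE -[t `^ r]inv_pow//.
by apply: chord_le_gamma => //; exact: inv_itv.
Qed.

End Converse.

Lemma leop_scaleD (R : realType) (H : hilbertType R) (c : R) (A B C : 'B(H)) :
  0 <= c -> A <=op B -> c%:C *: A + C <=op c%:C *: B + C.
Proof.
rewrite /loewner_le opprD addrACA subrr addr0 -scalerBr => c0 /positive_opP[sD D0].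
apply/positive_opP; split; first exact: selfadjZ.
by move=> x; rewrite scaleopE rdotZl mulr_ge0.
Qed.

Lemma unital_positive_leop (R : realType) (H K : hilbertType R)
    (Phi : {linear 'B(H) -> 'B(K)}) (A B : 'B(H)) :
  unital_positive Phi -> A <=op B -> Phi A <=op Phi B.
Proof. by move=> [_ hPhi] /hPhi; rewrite linearB. Qed.

Lemma unital_positive_pos_inv (R : realType) (H K : hilbertType R)
    (Phi : {linear 'B(H) -> 'B(K)}) (A : 'B(H)) :
  unital_positive Phi -> pos_inv A -> pos_inv (Phi A).
Proof.
move=> hPhi hA; have [c [_ [c0 _ cA _]]] := pos_inv_bounds hA.
have sA := pos_inv_selfadj hA.
apply: (@bounds_pos_inv _ _ _ c) => //.
  by apply: positive_selfadj; exact: (proj2 hPhi) (proj1 hA).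
move=> x; apply: leop_scalar_quad.
rewrite -(proj1 hPhi) -linearZ; apply: unital_positive_leop => //.
exact: quad_scalar_leop.
Qed.

Theorem theorem3p3 (R : realType) (H K : hilbertType R) (n : nat)
    (MH : ('I_n -> 'B(H)) -> 'B(H)) (MK : ('I_n -> 'B(K)) -> 'B(K))
    (hMH : n_operator_mean MH) (hMK : n_operator_mean MK)
    (w : 'I_n -> R) (hw : probability_vector w)
    (hMHw : between_harm_arith w MH) (hMKw : between_harm_arith w MK)
    (sigma : forall L : hilbertType R, 'B(L) -> 'B(L) -> 'B(L))
    (hsigma : operator_mean sigma) (hsigma_l : ~ left_trivial_mean sigma)
    (MHs : ('I_n -> 'B(H)) -> 'B(H)) (hMHs : is_deformed_mean MH (sigma H) MHs)
    (MKs : ('I_n -> 'B(K)) -> 'B(K)) (hMKs : is_deformed_mean MK (sigma K) MKs)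
    (A : 'I_n -> 'B(H)) (hA : forall j, pos_inv (A j))
    (m M : R) (hm : 0 < m) (hmM : m < M)
    (hmA : forall j, m%:C *: (1 : 'B(H)) <=op A j)
    (hAM : forall j, A j <=op M%:C *: (1 : 'B(H)))
    (alpha : R) (halpha : 0 < alpha)
    (r : R) (hr0 : 0 < r) (hr1 : r <= 1)
    (Phi : {linear 'B(H) -> 'B(K)}) (hPhi : unital_positive Phi) :
  MKs (fun j => Phi (pow_op (A j) r))
    <=op alpha%:C *: Phi (pow_op (MHs A) r)
         + (gamma_const M^-1 m^-1 (- r) alpha)%:C *: (1 : 'B(K)).
Proof.
have [f [fc fp hs [s s0 fs] [s' s0' fs']]] := operator_mean_tangents hsigma hsigma_l.
have inA j : op_in m M (A j).
  split=> [|x|x]; first exact: pos_inv_selfadj.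
    exact: leop_scalar_quad.
  by have := leop_quad x (hAM j); rewrite !opE rdotZl.
have hC j : pos_inv (Phi (pow_op (A j) r)).
  by apply: unital_positive_pos_inv => //; exact: pow_op_pos_inv.
have hK := deformed_le_arith hw fc fp (hs K) hMKw hMKs hC s0 fs.
have hH := harm_le_deformed hw fc fp (hs H) hMHw hMHs hA s0' fs'.
have hX : pos_inv (MHs A) by have [[]] := hMHs A hA.
have hS : pos_inv (\sum_(j < n) (w j)%:C *: inv_op (A j)).
  by apply: pos_inv_wsum => // j; exact: pos_inv_inv_op.
have hZ : pos_inv (harm_mean w A) by exact: pos_inv_inv_op.
have hLH := loewner_heinz hZ hX hH (ltW hr0) hr1.
have hMP := arith_pow_le_harm hw hm hmM halpha hr0 inA.
apply: leop_trans hK _.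
(* Linearity moves the arithmetic mean inside [Phi], back to [H], where the powers and the harmonic
   mean can be compared. *)
have -> : arith_mean w (fun j => Phi (pow_op (A j) r)) =
    Phi (arith_mean w (fun j => pow_op (A j) r)).
  by rewrite /arith_mean linear_sum; apply: eq_bigr => j _; rewrite linearZ.
have := unital_positive_leop hPhi hMP.
rewrite linearD !linearZ (proj1 hPhi) => /leop_trans; apply.
apply: leop_scaleD; first exact: ltW.
exact: unital_positive_leop.
Qed.
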